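(* Let $\mathcal{X}$, $\mathfrak{A}$, $\mathfrak{R}^{c}$, $\mathcal{A}^{c}$, $\mathcal{B}^{c}$, $\mathcal{K}$, $\mathcal{K}^{n}$, $\mathcal{A}^{dc}$, $\mathcal{A}^{cl}=\mathcal{A}^{cl}(n)$ and the eigenvalues $\{\lambda^{dc}_i\}_{i=1}^\infty=\sigma(\mathcal{A}^{dc})$ be as described in the context. Assume that $\mathcal{A}^{dc}$ is a discrete Riesz-spectral operator with simple eigenvalues and that there is a constant $M\in[0,\infty)$ such that $$\sum_{i=1}^\infty\left|\frac{b^{dc}_i}{\lambda-\lambda^{dc}_i}\right|^2\le M\qquad\text{for all }\lambda\in\mathbb{C}\setminus D .$$ For $\epsilon\in(0,1)$ let $D_i^\epsilon=\{z\in\mathbb{C}: |z-\lambda^{dc}_i|<\epsilon\, d_i/3\}$ and $D^\epsilon=\bigcup_{i=1}^\infty D_i^\epsilon$. Then for each $\epsilon\in(0,1)$ there exists $n_\epsilon\in\mathbb{N}$ such that for all $n\ge n_\epsilon$ the spectrum of $\mathcal{A}^{cl}=\mathcal{A}^{c}+\mathcal{B}^{c}\mathcal{K}^{n}$, given by $\sigma(\mathcal{A}^{cl})=\{\lambda_i^{cl}\}_{i=1}^\infty$, satisfies: (a) $\sigma(\mathcal{A}^{cl})\subset D^\epsilon$; (b) each disk $D_i^\epsilon$ contains one and only one eigenvalue $\lambda^{cl}_i\in\sigma(\mathcal{A}^{cl})$, and it is of simple algebraic multiplicity.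
   Context: Setting. $\mathcal{X}$ is a separable complex Hilbert space and $\mathcal{U}=\mathbb{C}$. The scalar product and duality pairings take complex conjugation on the second argument. For Banach spaces $\mathcal M,\mathcal N$, $\mathscr{L}(\mathcal M,\mathcal N)$ is the space of bounded linear operators; domains of operators carry the graph norm and $D(\cdot)'$ denotes the dual space. Boundary control system. The plant is $\dot x(t)=\mathfrak{A}x(t)$, $u(t)=\mathfrak{R}x(t)$, with unbounded operators $\mathfrak{A}:\mathcal{X}\supset D(\mathfrak{A})\to\mathcal{X}$ and $\mathfrak{R}:\mathcal{X}\supset D(\mathfrak{A})\to\mathcal{U}$. To a boundary control system $(\mathfrak{A},\mathfrak{R})$ one associates: - the operator $\Sigma:\mathcal{X}\times\mathcal{U}\supset D(\Sigma)\to\mathcal{X}$, $\Sigma(h_x,h_u)=\mathfrak{A}h_x$, with $D(\Sigma)=\{(h_x,h_u)\in D(\mathfrak{A})\times\mathcal{U}:\mathfrak{R}h_x=h_u\}$ dense in $\mathcal{X}\times\mathcal{U}$; - the system operator $\mathcal{A}h=\mathfrak{A}h$ with $D(\mathcal{A})=\{h\in D(\mathfrak{A}):\mathfrak{R}h=0\}$; - the input operator $\mathcal{B}\in\mathscr{L}(\mathcal{U},D(\mathcal{A}^* )')$, defined by $\langle\mathcal{B},h\rangle=\langle(0,1),\Sigma^*h\rangle_{\mathcal{X}\times\mathcal{U}}$ for $h\in D(\Sigma^* )$. The plant operator $\mathcal{A}$ is assumed to generate a $C_0$-semigroup on $\mathcal{X}$; $\mathcal{B}$ need not be admissible. Desired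 system. $\mathfrak{R}^{dc}\in\mathscr{L}(D(\mathfrak{A}),\mathcal{U})$ is a desired boundary operator; $(\mathcal{A}^{dc},\mathcal{B}^{dc})$ denotes the system operator and input operator associated with the boundary control system $(\mathfrak{A},\mathfrak{R}^{dc})$, i.e. $\mathcal{A}^{dc}h=\mathfrak{A}h$ with $D(\mathcal{A}^{dc})=\{h\in D(\mathfrak{A}):\mathfrak{R}^{dc}h=0\}$, and $\mathcal{B}^{dc}\in\mathscr{L}(\mathcal{U},D(\mathcal{A}^{dc*})')$ is defined by $\langle\mathcal{B}^{dc},h\rangle=\langle(0,1),\Sigma^{dc*}h\rangle_{\mathcal{X}\times\mathcal{U}}$ for $h\in D(\Sigma^{dc*})$, where $\Sigma^{dc}(h_x,h_u)=\mathfrak{A}h_x$ with $D(\Sigma^{dc})=\{(h_x,h_u)\in D(\mathfrak{A})\times\mathcal{U}:\mathfrak{R}^{dc}h_x=h_u\}$. Feedback. With a nonzero real constant $\varkappa$, the feedback gain achieving the desired dynamics is $\breve{\mathfrak{K}}=\mathfrak{R}-\varkappa\mathfrak{R}^{dc}\in\mathscr{L}(D(\mathfrak{A}),\mathcal{U})$. It is decomposed as $\breve{\mathfrak{K}}=\mathring{\mathfrak{K}}+\mathcal{K}$ with $\mathring{\mathfrak{K}}\in\mathscr{L}(D(\mathfrak{A}),\mathcal{U})$ (unbounded part) and $\mathcal{K}=\langle\cdot,k\rangle_{\mathcal{X}}\in\mathscr{L}(\mathcal{X},\mathcal{U})$, $k\in\mathcal{X}$ (bounded part). Intermediate system. $\mathfrak{R}^{c}=\mathfrak{R}-\mathring{\mathfrak{K}}$,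 and $(\mathcal{A}^{c},\mathcal{B}^{c})$ denotes the system operator and input operator associated with $(\mathfrak{A},\mathfrak{R}^{c})$. Then $\mathcal{A}^{dc}=\mathcal{A}^{c}+\mathcal{B}^{c}\mathcal{K}$ (viewed as an operator from $\mathcal{X}$ to $D(\mathcal{A}^{c*})'$), i.e. $D(\mathcal{A}^{dc})=\{h\in D(\mathfrak{A}):\mathfrak{R}^{c}h=\mathcal{K}h\}$; moreover $D(\mathcal{A}^{dc*})=D(\mathcal{A}^{c*})$ and $\mathcal{B}^{dc}=\varkappa\mathcal{B}^{c}$. Approximation. $\{\mathcal{X}^n\}$ is a sequence of $n$-dimensional subspaces of $\mathcal{X}$ such that every element of $\mathcal{X}$ is a limit of elements $x^n\in\mathcal{X}^n$. The bounded part is approximated by $\mathcal{K}^n=\langle\cdot,k^n\rangle_{\mathcal{X}}$ with $k^n\in\mathcal{X}^n$ and $\mathcal{K}^n\to\mathcal{K}$, i.e. $\|k-k^n\|_{\mathcal{X}}\to0$ as $n\to\infty$. The closed-loop operator is $\mathcal{A}^{cl}=\mathcal{A}^{c}+\mathcal{B}^{c}\mathcal{K}^n$, i.e. $\mathcal{A}^{cl}h=\mathfrak{A}h$ with $D(\mathcal{A}^{cl})=\{h\in D(\mathfrak{A}):\mathfrak{R}^{c}h=\mathcal{K}^nh\}$. Spectral notions. ''Discrete'' means that the operator has compact resolvent; ''Riesz-spectral'' means (for simple eigenvalues) that the operator is closed and its eigenvectors can be chosen to form a Riesz basis of $\mathcal{X}$. Let $\{\varphi_i^{dc}\}$ be the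 Riesz basis of eigenvectors of $\mathcal{A}^{dc}$ for the eigenvalues $\{\lambda_i^{dc}\}$, and $\{\varphi_i^{dc*}\}$ the eigenvectors of the adjoint $\mathcal{A}^{dc*}$, normalized so that $\langle\varphi_i^{dc},\varphi_j^{dc*}\rangle_{\mathcal{X}}=\delta_{ij}$. Put $b_i^{dc}=\langle\mathcal{B}^{dc},\varphi_i^{dc*}\rangle_{D(\mathcal{A}^{dc*})}$. Let $d_i$ be the distance from $\lambda_i^{dc}$ to the rest of $\sigma(\mathcal{A}^{dc})$, $D_i=\{z\in\mathbb{C}:|z-\lambda_i^{dc}|<d_i/3\}$ and $D=\bigcup_{i=1}^\infty D_i$. *)

(* Defs.v *)
From HB Require Import structures.
From mathcomp Require Import all_boot all_order all_algebra.
From mathcomp Require Import sesquilinear complex.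
From mathcomp Require Import all_classical all_reals all_analysis.

Set Implicit Arguments.
Unset Strict Implicit.
Unset Printing Implicit Defensive.

Import Order.TTheory GRing.Theory Num.Theory.
Import numFieldNormedType.Exports.
Import Normc.

Local Open Scope classical_set_scope.
Local Open Scope ring_scope.
Local Open Scope complex_scope.

(* The field of complex numbers is R[i], for R : realType. Norms of vectors
   take their (real) values in R[i]; [normc] is the modulus with values in R. *)

(* An operator defined on a subset [dom] of X; the values of [op] outside [dom]
   are irrelevant. *)
Record unbounded_operator (X Y : Type) :=
  UnboundedOperator { dom : set X ; op :> X -> Y }.

Section LinearNotions.
Variable R : realType.
Implicit Types X Y : lmodType R[i].

Definition linear_on X Y (D : set X) (f : X -> Y) : Prop :=
  D 0 /\
  forall (a : R[i]) x y, D x -> D y ->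
    D (a *: x + y) /\ f (a *: x + y) = a *: f x + f y.

Definition has_dimension X (n : nat) (V : set X) : Prop :=
  exists e : 'I_n -> X,
    (forall a : 'I_n -> R[i],
       \sum_(i < n) a i *: e i = 0 -> forall i, a i = 0) /\
    V = [set x | exists a : 'I_n -> R[i], x = \sum_(i < n) a i *: e i].

Definition linear_span X (phi : nat -> X) : set X :=
  [set x | exists n (a : 'I_n -> R[i]), x = \sum_(i < n) a i *: phi i].

End LinearNotions.

Section Spectrum.
Variables (R : realType) (X : normedModType R[i]).
Implicit Types (A : unbounded_operator X X) (l : R[i]) (S : {linear X -> X}).

Definition closed_operator A : Prop :=
  closed [set p : X * X | dom A p.1 /\ A p.1 = p.2].

(* S is the bounded, everywhere defined, two-sided inverse of l - A. *)
Definition is_resolvent A l S : Prop :=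
  continuous S /\
  (forall x, dom A (S x) /\ l *: S x - A (S x) = x) /\
  (forall h, dom A h -> S (l *: h - A h) = h).

Definition resolvent_set A : set R[i] := [set l | exists S, is_resolvent A l S].

Definition spectrum A : set R[i] := ~` resolvent_set A.

Definition compact_operator (f : X -> X) : Prop :=
  precompact (f @` [set x | `|x| <= 1]).

Definition discrete_operator A : Prop :=
  exists l S, is_resolvent A l S /\ compact_operator S.

Definition eigenvector A l (x : X) : Prop :=
  [/\ dom A x, x != 0 & A x = l *: x].

Definition eigenvalue A l : Prop := exists x, eigenvector A l x.

(* x belongs to the domain of (A - l)^j and (A - l)^j x = 0 *)
Fixpoint in_ker_pow A l (j : nat) (x : X) : Prop :=
  if j is j'.+1 then dom A x /\ in_ker_pow A l j' (A x - l *: x) else x = 0.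

Definition root_space A l : set X := [set x | exists j, in_ker_pow A l j x].

Definition algebraic_multiplicity A l (m : nat) : Prop :=
  has_dimension m (root_space A l).

Definition simple_eigenvalue A l : Prop :=
  eigenvalue A l /\ algebraic_multiplicity A l 1.

Definition riesz_basis (phi : nat -> X) : Prop :=
  dense (linear_span phi) /\
  exists m M : R, [/\ 0 < m, 0 < M &
    forall n (a : 'I_n -> R[i]),
      m%:C * \sum_(i < n) `|a i| ^+ 2 <= `|\sum_(i < n) a i *: phi i| ^+ 2 /\
      `|\sum_(i < n) a i *: phi i| ^+ 2 <= M%:C * \sum_(i < n) `|a i| ^+ 2].

(* Riesz-spectral operator, together with its eigenvalues [lam] and the Riesz
   basis [phi] formed by associated eigenvectors. *)
Definition riesz_spectral A (lam : nat -> R[i]) (phi : nat -> X) : Prop :=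
  [/\ closed_operator A, forall i, eigenvector A (lam i) (phi i)
    & riesz_basis phi].

Definition separable : Prop := exists D : set X, countable D /\ dense D.

Definition generates_C0_semigroup A : Prop :=
  exists T : R -> {linear X -> X},
    (forall t, 0 <= t -> continuous (T t)) /\
    (forall x, T 0 x = x) /\
    (forall s t x, 0 <= s -> 0 <= t -> T (s + t) x = T s (T t x)) /\
    (forall x, T t x @[t --> 0^'+] --> x) /\
    (forall x y, dom A x /\ A x = y <->
       (t^-1)%:C *: (T t x - x) @[t --> 0^'+] --> y).

(* F \in L(D(A), C), where D(A) carries the graph norm |h| + |A h| *)
Definition bounded_functional A (F : X -> R[i]) : Prop :=
  linear_on (dom A) (F : X -> R[i]^o) /\
  exists c : R, forall h, dom A h -> `|F h| <= c%:C * (`|h| + `|A h|).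

End Spectrum.

Section Disks.
Variable R : realType.

Definition dist_to_rest (S : set R[i]) (z : R[i]) : R :=
  inf [set normc (z - w) | w in S `\ z].

(* the open disk of center z and radius e * d / 3, where d is the distance from
   z to the other points of S *)
Definition isolating_disk (S : set R[i]) (e : R) (z : R[i]) : set R[i] :=
  [set w | normc (w - z) < e * dist_to_rest S z / 3].

End Disks.

Section Adjoint.
Variables (R : realType) (X Y : lmodType R[i]).
Variables (ipX : X -> X -> R[i]) (ipY : Y -> Y -> R[i]).

Definition adjoint_pair (T : unbounded_operator X Y) (y : Y) (z : X) : Prop :=
  forall x, dom T x -> ipY (T x) y = ipX x z.

(* For a densely defined T the z below is unique. *)
Definition adjoint (T : unbounded_operator X Y) : unbounded_operator Y X :=
  UnboundedOperator [set y | exists z, adjoint_pair T y z]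
                    (fun y => xget 0 [set z | adjoint_pair T y z]).

End Adjoint.

Section BoundaryControl.
Variables (R : realType) (X : normedModType R[i]) (ip : X -> X -> R[i]).
Implicit Types (A : unbounded_operator X X) (F : X -> R[i]).

Definition ip_prod (p q : X * R[i]^o) : R[i] :=
  ip p.1 q.1 + (p.2 : R[i]) * (q.2 : R[i])^*.

Definition Sigma A F : unbounded_operator (X * R[i]^o)%type X :=
  UnboundedOperator [set p | dom A p.1 /\ F p.1 = p.2] (fun p => A p.1).

Definition boundary_control_system A F : Prop :=
  [/\ linear_on (dom A) A, linear_on (dom A) (F : X -> R[i]^o)
    & dense (dom (Sigma A F))].

Definition system_operator A F : unbounded_operator X X :=
  UnboundedOperator [set h | dom A h /\ F h = 0] A.

(* h |-> <B, h>, on the domain of (Sigma A F)^* *)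
Definition input_operator A F : X -> R[i] :=
  fun h => ip_prod (0, 1) (adjoint ip_prod ip (Sigma A F) h).

(* For the system and input operators A0, B0 of (A, F), this is A0 + B0 K with
   the bounded feedback K = <., k>: the operator A restricted by the boundary
   condition F h = K h. *)
Definition closed_loop A F (k : X) : unbounded_operator X X :=
  UnboundedOperator [set h | dom A h /\ F h = ip h k] A.

End BoundaryControl.

(* Main.v *)
Require Import Defs.
From HB Require Import structures.
From mathcomp Require Import all_boot all_order all_algebra.
From mathcomp Require Import sesquilinear complex.
From mathcomp Require Import all_classical all_reals all_analysis.
From mathcomp Require Import ring lra.

Set Implicit Arguments.
Unset Strict Implicit.
Unset Printing Implicit Defensive.

Import Order.TTheory GRing.Theory Num.Theory.
Import numFieldNormedType.Exports.
Import Normc.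

Local Open Scope classical_set_scope.
Local Open Scope ring_scope.
Local Open Scope complex_scope.

(** In the Riesz basis [phi] the desired operator is diagonal, and the triple
    (A, boundary value, input) reads, with [x_j := ip x (phis j)],
    [(A h)_j = lam_j h_j + (Rdc h) b_j] on all of [dom A]. The closed loop is the
    boundary condition [Rdc h = ip h g] with [g = (kn - k) / kappa -> 0], so its
    eigenvalue problem is [(l - lam_j) h_j = x_j + (ip h g) b_j].
    Near [lam_i] every coordinate but the i-th can be solved, and [l] is a
    spectral point iff
    [l = lam_i + b_i (ip phi_i g) / (1 - ip E_l g)], where [E_l] has coordinates
    [b_j / (l - lam_j)], [j <> i]. The summability bound controls [|b_i| / d_i]
    and [|E_l|] uniformly in [i], so for small [g] the right-hand side is a
    contraction of the disk of radius [eps d_i / 6] around [lam_i], uniformly in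
    [i]: its unique fixed point is the perturbed eigenvalue. This replaces
    Rouche's theorem. Outside the disks of radius [d_i / 3] the same reduction
    with [i = 0] gives a resolvent. *)


(** * The modulus on R[i] *)

Section Modulus.
Variable R : realType.
Implicit Types z w : R[i].

Lemma normc_ge0 z : 0 <= normc z.
Proof. by case: z => a b; exact: sqrtr_ge0. Qed.

Lemma normcE z : `|z| = (normc z)%:C.
Proof. by []. Qed.

Lemma normcD z w : normc (z + w) <= normc z + normc w.
Proof. by rewrite -lecR rmorphD /= -!normcE ler_normD. Qed.

Lemma normcN z : normc (- z) = normc z.
Proof. by case: z => a b /=; rewrite !sqrrN. Qed.

Lemma normc_distC z w : normc (z - w) = normc (w - z).
Proof. by rewrite -normcN opprB. Qed.

Lemma normc_real (a : R) : normc a%:C = `|a|.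
Proof. by rewrite /normc /= expr0n/= addr0 sqrtr_sqr. Qed.

Lemma normc_eq0 z : (normc z == 0) = (z == 0).
Proof.
by apply/eqP/eqP => [/eq0_normc //|->]; exact: normc0.
Qed.

Lemma normc_gt0 z : (0 < normc z) = (z != 0).
Proof. by rewrite lt_neqAle normc_ge0 andbT eq_sym normc_eq0. Qed.

Lemma normc_Re_le z : `|complex.Re z| <= normc z.
Proof.
case: z => a b /=; rewrite -sqrtr_sqr ler_wsqrtr // lerDl sqr_ge0 //.
Qed.

Lemma normc_Im_le z : `|complex.Im z| <= normc z.
Proof.
case: z => a b /=; rewrite -sqrtr_sqr ler_wsqrtr // lerDr sqr_ge0 //.
Qed.

Lemma normc_le_ReIm z : normc z <= `|complex.Re z| + `|complex.Im z|.
Proof.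
case: z => a b /=.
rewrite -[leRHS]ger0_norm ?addr_ge0 // -[leRHS]sqrtr_sqr ler_wsqrtr //.
rewrite -[a ^+ 2]real_normK ?num_real // -[b ^+ 2]real_normK ?num_real //.
by have := normr_ge0 a; have := normr_ge0 b; nra.
Qed.

(** * Completeness and contractions in the complex plane *)

Lemma real_cauchy_cvg (u : nat -> R) :
  (forall e, 0 < e ->
    exists N, forall m n, (N <= m)%N -> (N <= n)%N -> `|u m - u n| < e) ->
  exists l, forall e, 0 < e -> exists N, forall n, (N <= n)%N -> `|u n - l| < e.
Proof.
move=> cu; have /cauchy_cvgP cv : cauchy (u @ \oo).
  apply/cauchy_ballP => e e0; near_simpl; have [N HN] := cu _ e0.
  exists ([set n | N <= n]%N, [set n | N <= n]%N); first by split; exists N.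
  by case=> m n [/= hm hn]; apply: HN.
exists (lim (u @ \oo)) => e e0.
have /cvgrPdist_lt/(_ _ e0)[N _ HN] := cv.
by exists N => n hn; rewrite distrC; exact: HN.
Qed.

Lemma complex_cauchy_cvg (u : nat -> R[i]) :
  (forall e, 0 < e ->
    exists N, forall m n, (N <= m)%N -> (N <= n)%N -> normc (u m - u n) < e) ->
  exists l, forall e, 0 < e ->
    exists N, forall n, (N <= n)%N -> normc (u n - l) < e.
Proof.
move=> cu.
have [|a Ha] := @real_cauchy_cvg (fun n => complex.Re (u n)).
  move=> e /cu[N HN]; exists N => m n hm hn.
  by rewrite (le_lt_trans _ (HN m n hm hn)) // -raddfB normc_Re_le.
have [|b Hb] := @real_cauchy_cvg (fun n => complex.Im (u n)).
  move=> e /cu[N HN]; exists N => m n hm hn.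
  by rewrite (le_lt_trans _ (HN m n hm hn)) // -raddfB normc_Im_le.
exists (a +i* b)%C => e e0.
have [N1 H1] := Ha (e / 2) (divr_gt0 e0 (ltr0n _ 2)).
have [N2 H2] := Hb (e / 2) (divr_gt0 e0 (ltr0n _ 2)).
exists (maxn N1 N2) => n; rewrite geq_max => /andP[/H1 h1 /H2 h2].
rewrite (le_lt_trans (normc_le_ReIm _)) // [e]splitr.
by case: (u n) h1 h2 => c d /= h1 h2; rewrite ltrD.
Qed.

(** Banach's fixed point theorem on a closed disk, by iteration from the centre. *)
Lemma disk_fixed_point (T : R[i] -> R[i]) (c : R[i]) (r : R) :
  0 <= r ->
  (forall z, normc (z - c) <= r -> normc (T z - c) <= r) ->
  (forall z w, normc (z - c) <= r -> normc (w - c) <= r ->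
     normc (T z - T w) <= 2^-1 * normc (z - w)) ->
  exists z, normc (z - c) <= r /\ T z = z.
Proof.
move=> r0 Tr Tc; pose u n := iter n T c.
have ur n : normc (u n - c) <= r.
  by elim: n => [|n ih]; [rewrite subrr normc0 | exact: Tr].
(* As the iteration starts at [c], the case n = 0 is the disk bound itself, and each further
   application of [T] halves the distance. *)
have udiff n p : normc (u n - u (n + p)%N) <= r * 2^-1 ^+ n.
  elim: n => [|n ih].
    by rewrite add0n normc_distC expr0 mulr1 /= ur.
  rewrite addSn /= (le_trans (Tc _ _ (ur _) (ur _))) // exprS mulrCA.
  by rewrite ler_pM2l ?invr_gt0.
have small e : 0 < e -> exists n, r * 2^-1 ^+ n < e.
  move=> e0; have [n Hn] : exists n : nat, r / e < n%:R.
    by exists (Num.bound (r / e)); rewrite archi_boundP // divr_ge0 // ltW.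
  exists n; rewrite exprVn ltr_pdivrMr ?exprn_gt0 // mulrC -ltr_pdivrMr //.
  by rewrite (lt_le_trans Hn) // -natrX ler_nat ltnW // ltn_expl.
have mono n m : (n <= m)%N -> r * 2^-1 ^+ m <= r * 2^-1 ^+ n.
  by move=> nm; rewrite ler_wpM2l // ler_wiXn2l //; lra.
have [e e0|z Hz] := @complex_cauchy_cvg u.
  have [N HN] := small _ e0; exists N => m n.
  wlog mn : m n / (m <= n)%N => [W hm hn|hm hn].
    by case/orP: (leq_total m n) => mn; [|rewrite normc_distC]; apply: W.
  by rewrite -(subnKC mn) (le_lt_trans (udiff _ _)) // (le_lt_trans (mono _ _ hm)).
have zr : normc (z - c) <= r.
  apply/ler_addgt0Pr => e e0; have [N /(_ N (leqnn _)) HN] := Hz _ e0.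
  rewrite -[z - c](subrKA (u N)) (le_trans (normcD _ _)) // addrC lerD //.
  by rewrite normc_distC ltW.
exists z; split => //; apply/eqP; rewrite -subr_eq0 -normc_eq0.
rewrite eq_le normc_ge0 andbT; apply/ler_addgt0Pr => e e0; rewrite add0r.
have [N HN] := Hz _ (divr_gt0 e0 (ltr0n _ 2)).
rewrite -[T z - z](subrKA (u N.+1)) (le_trans (normcD _ _)) //.
have h1 := HN _ (leqnn _); have h2 := HN _ (leqnSn _).
have h3 := Tc _ _ zr (ur N); rewrite normc_distC in h1.
rewrite -[u N.+1]/(T (u N)) in h2 *; lra.
Qed.

End Modulus.

(** * Real-valued norms and the inner product *)

Section RealNorm.
Variables (R : realType) (X : normedModType R[i]).
Implicit Types x y : X.

(** The norm of [X] takes values in [R[i]]; this real-valued copy lets estimates be carried out in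
    the ordered field [R]. *)
Definition rnorm x : R := complex.Re `|x|.

Lemma rnormE x : `|x| = (rnorm x)%:C.
Proof.
rewrite /rnorm; have := normr_ge0 x; case: (`|x|) => a b /=.
by rewrite lecE /= => /andP[/eqP -> _].
Qed.

Lemma rnorm_ge0 x : 0 <= rnorm x.
Proof. by rewrite -lecR -rnormE normr_ge0. Qed.

Lemma rnormZ (a : R[i]) x : rnorm (a *: x) = normc a * rnorm x.
Proof. by apply: complexI; rewrite rmorphM /= -!rnormE normrZ normcE. Qed.

Lemma rnormD x y : rnorm (x + y) <= rnorm x + rnorm y.
Proof. by rewrite -lecR rmorphD /= -!rnormE ler_normD. Qed.

Lemma rnormN x : rnorm (- x) = rnorm x.
Proof. by rewrite /rnorm normrN. Qed.

Lemma rnorm_distC x y : rnorm (x - y) = rnorm (y - x).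
Proof. by rewrite /rnorm distrC. Qed.

Lemma rnorm0 : rnorm 0 = 0.
Proof. by rewrite /rnorm normr0. Qed.

Lemma rnorm_eq0 x : (rnorm x == 0) = (x == 0).
Proof. by rewrite -(normr_eq0 x) (rnormE x) -(inj_eq (@complexI R)). Qed.

Lemma rnorm_gt0 x : (0 < rnorm x) = (x != 0).
Proof. by rewrite lt_neqAle rnorm_ge0 andbT eq_sym rnorm_eq0. Qed.

Lemma rnorm_sum (I : Type) (r : seq I) (P : pred I) (F : I -> X) :
  rnorm (\sum_(i <- r | P i) F i) <= \sum_(i <- r | P i) rnorm (F i).
Proof.
elim/big_ind2: _ => [|x a y b xa yb|//]; first by rewrite rnorm0.
by rewrite (le_trans (rnormD _ _)) // lerD.
Qed.

Lemma rnorm_small_eq0 x : (forall e, 0 < e -> rnorm x <= e) -> x = 0.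
Proof.
move=> H; apply/eqP; rewrite -rnorm_eq0 eq_le rnorm_ge0 andbT.
by apply/ler_addgt0Pr => e e0; rewrite add0r; exact: H.
Qed.

Lemma cvg_rnormP (u : nat -> X) x :
  u n @[n --> \oo] --> x <->
  forall e, 0 < e -> exists N, forall n, (N <= n)%N -> rnorm (u n - x) < e.
Proof.
split=> [/cvgrPdist_lt H e e0|H].
  have [|N _ HN] := H e%:C; first by rewrite ltcR.
  exists N => n hn; have := HN n hn.
  by rewrite /= rnormE ltcR rnorm_distC.
(* A positive element of [R[i]] has zero imaginary part, so only real radii matter. *)
apply/cvgrPdist_lt => -[e e'] /[!ltcE] /= /andP[/eqP -> e0].
have [N HN] := H e e0; exists N => // n hn /=.
by rewrite rnormE -[(_ +i* _)%C]/(e%:C) ltcR rnorm_distC; exact: HN.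
Qed.

Lemma dense_rnorm (D : set X) x e : dense D -> 0 < e ->
  exists2 y, D y & rnorm (x - y) < e.
Proof.
move=> dD e0; have e0' : 0 < e%:C by rewrite ltcR.
have [||y []] := dD (ball x e%:C).
- by exists x; exact: ballxx.
- exact: ball_open.
rewrite -ball_normE /= rnormE ltcR => h Dy.
by exists y.
Qed.

Lemma linear_rnorm_continuous (S : {linear X -> X}) c :
  (forall x, rnorm (S x) <= c * rnorm x) -> continuous S.
Proof.
move=> Sc; apply: bounded_linear_continuous; apply/linear_boundedP.
exists c%:C; split.
  by apply/complex_realP; exists c.
move=> r cr x; rewrite !rnormE (le_trans (y := (c * rnorm x)%:C)) ?lecR //.
by rewrite rmorphM /= ler_wpM2r ?lecR ?rnorm_ge0 // ltW.
Qed.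

Lemma linear_continuous_rnorm (S : {linear X -> X}) :
  continuous S -> exists2 c, 0 < c & forall x, rnorm (S x) <= c * rnorm x.
Proof.
move=> /linear_bounded_continuous/linear_boundedP/pinfty_ex_gt0.
move=> [[c d] /[!ltcE] /= /andP[/eqP -> c0] H]; exists c => // x.
by rewrite -lecR rmorphM /= -!rnormE; exact: H.
Qed.

End RealNorm.

Lemma rnorm_complete (R : realType) (X : completeNormedModType R[i])
    (u : nat -> X) :
  (forall e, 0 < e ->
    exists N, forall m n, (N <= m)%N -> (N <= n)%N -> rnorm (u m - u n) < e) ->
  exists l, forall e, 0 < e -> exists N, forall n, (N <= n)%N -> rnorm (u n - l) < e.
Proof.
move=> cu; have /cauchy_cvgP cv : cauchy (u @ \oo).
  apply/cauchy_ballP => -[e e'] /[!ltcE] /= /andP[/eqP -> e0].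
  near_simpl; have [N HN] := cu _ e0.
  exists ([set n | N <= n]%N, [set n | N <= n]%N); first by split; exists N.
  case=> m n [/= hm hn]; rewrite -ball_normE /= rnormE.
  by rewrite -[(_ +i* _)%C]/(e%:C) ltcR HN.
by exists (lim (u @ \oo)); apply/cvg_rnormP.
Qed.

Section InnerProduct.
Variables (R : realType) (X : normedModType R[i]) (ip : {dot X for conjc}).
Hypothesis ip_norm : forall x : X, `|x| ^+ 2 = ip x x.
Implicit Types x y z : X.

Lemma ipDl x y z : ip (x + y) z = ip x z + ip y z.
Proof. by rewrite linearDl. Qed.

Lemma ipBl x y z : ip (x - y) z = ip x z - ip y z.
Proof. by rewrite linearBl. Qed.

Lemma ipZl (a : R[i]) x y : ip (a *: x) y = a * ip x y.
Proof. by rewrite linearZl_LR. Qed.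

Lemma ip0l y : ip 0 y = 0.
Proof. by rewrite linear0l. Qed.

Lemma ipDr x y z : ip x (y + z) = ip x y + ip x z.
Proof. by rewrite linearD. Qed.

Lemma ipBr x y z : ip x (y - z) = ip x y - ip x z.
Proof. by rewrite linearB. Qed.

Lemma ipZr (a : R[i]) x y : ip x (a *: y) = conjc a * ip x y.
Proof. by rewrite linearZr_LR. Qed.

Lemma ip_suml (I : Type) (r : seq I) (P : pred I) (F : I -> X) y :
  ip (\sum_(i <- r | P i) F i) y = \sum_(i <- r | P i) ip (F i) y.
Proof.
by elim/big_rec2: _ => [|i a b _ <-]; [exact: ip0l | rewrite ipDl].
Qed.

Lemma ip_rnorm x : ip x x = (rnorm x ^+ 2)%:C.
Proof. by rewrite -ip_norm rnormE rmorphXn. Qed.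

(** With [a *: y] the orthogonal projection of [x] on [y] and [u] the remainder, Pythagoras bounds
    [a *: y] by [x]. *)
Lemma cauchy_schwarz x y : normc (ip x y) <= rnorm x * rnorm y.
Proof.
have [->|y0] := eqVneq y 0; first by rewrite linear0r normc0 rnorm0 mulr0.
have yy0 : ip y y != 0.
  by rewrite -ip_norm expf_neq0 // normr_eq0.
pose a := ip x y / ip y y; pose u := x - a *: y.
have uy : ip u y = 0 by rewrite ipBl ipZl divfK ?subrr.
have yu : ip y u = 0.
  by have := hermC ip y u => /= ->; rewrite /= uy conjc0 mulr0.
have xE : x = u + a *: y by rewrite subrK.
clearbody u.
have : rnorm x ^+ 2 = rnorm u ^+ 2 + (normc a * rnorm y) ^+ 2.
  apply: complexI; rewrite rmorphD /= -rnormZ -!ip_rnorm {1 2}xE.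
  by rewrite ipDl !ipDr !(ipZl, ipZr) uy yu !mulr0 addr0 add0r.
move=> E; have -> : normc (ip x y) = normc a * rnorm y * rnorm y.
  rewrite [in LHS]xE ipDl ipZl uy add0r normcM ip_rnorm normc_real.
  by rewrite ger0_norm ?sqr_ge0 // expr2 mulrA.
rewrite ler_wpM2r ?rnorm_ge0 //.
rewrite -(@ler_pXn2r _ 2) ?nnegrE ?mulr_ge0 ?rnorm_ge0 ?normc_ge0 //.
by rewrite E lerDr sqr_ge0.
Qed.

Lemma ip_prodE (p q : X * R[i]^o) :
  ip_prod ip p q = ip p.1 q.1 + p.2 * conjc q.2.
Proof. by []. Qed.

End InnerProduct.


(** * Riesz bases *)

Lemma nondecreasing_bounded_tail (R : realType) (S : nat -> R) (B : R) :
  {homo S : m n / (m <= n)%N >-> m <= n} -> (forall n, S n <= B) ->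
  forall e, 0 < e -> exists N, forall n, (N <= n)%N -> S n - S N < e.
Proof.
move=> Sm SB e e0.
have hS : has_sup (range S).
  by split; [exists (S 0%N); exists 0%N | exists B => _ [n _ <-]; exact: SB].
have [_ [N _ <-] hN] := sup_adherent e0 hS.
exists N => n _; have : S n <= sup (range S).
  by apply: sup_upper_bound => //; exists n.
move: hN; lra.
Qed.

Section RieszBounds.
Variables (R : realType) (X : normedModType R[i]).

(** The frame inequalities are moved to [R], with coefficients indexed by [nat] so that one sequence
    serves all truncations. *)
Lemma riesz_basis_bounds (phi : nat -> X) : riesz_basis phi ->
  dense (linear_span phi) /\
  exists m M : R, [/\ 0 < m, 0 < M &
    forall n (a : nat -> R[i]),
      m * \sum_(i < n) normc (a i) ^+ 2 <=
        rnorm (\sum_(i < n) a i *: phi i) ^+ 2 /\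
      rnorm (\sum_(i < n) a i *: phi i) ^+ 2 <=
        M * \sum_(i < n) normc (a i) ^+ 2].
Proof.
move=> [dphi [m [M [m0 M0 H]]]]; split => //; exists m, M; split => // n a.
have [h1 h2] := H n (fun i => a i).
have sE : \sum_(i < n) `|a i| ^+ 2 = (\sum_(i < n) normc (a i) ^+ 2)%:C.
  by rewrite rmorph_sum; apply: eq_bigr => i _; rewrite rmorphXn.
have rE y : `|y : X| ^+ 2 = (rnorm y ^+ 2)%:C by rewrite rnormE rmorphXn.
by move: h1 h2; rewrite sE rE -!rmorphM !lecR.
Qed.

End RieszBounds.

Section RieszBasis.
Variables (R : realType) (X : completeNormedModType R[i]).
Variable ip : {dot X for conjc}.
Hypothesis ip_norm : forall x : X, `|x| ^+ 2 = ip x x.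
Variables phi phis : nat -> X.
Hypothesis biorth : forall i j, ip (phi i) (phis j) = (i == j)%:R.
Hypothesis phi_dense : dense (linear_span phi).
Variables m M : R.
Hypotheses (m_gt0 : 0 < m) (M_gt0 : 0 < M).
Hypothesis frame : forall n (a : nat -> R[i]),
  m * \sum_(i < n) normc (a i) ^+ 2 <= rnorm (\sum_(i < n) a i *: phi i) ^+ 2 /\
  rnorm (\sum_(i < n) a i *: phi i) ^+ 2 <= M * \sum_(i < n) normc (a i) ^+ 2.
Implicit Types (x y : X) (a mu : nat -> R[i]).

Definition expansion n x : X := \sum_(i < n) ip x (phis i) *: phi i.

Lemma coef_sum n a j :
  ip (\sum_(i < n) a i *: phi i) (phis j) = if (j < n)%N then a j else 0.
Proof.
rewrite ip_suml; case: ltnP => jn.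
  rewrite (bigD1 (Ordinal jn)) //= ipZl biorth eqxx mulr1 big1 ?addr0 // => i ij.
  rewrite ipZl biorth; suff /negbTE -> : nat_of_ord i != j by rewrite mulr0.
  by apply: contra ij => /eqP ij; apply/eqP/val_inj.
rewrite big1 // => i _; rewrite ipZl biorth.
by rewrite (ltn_eqF (leq_trans (ltn_ord i) jn)) mulr0.
Qed.

Lemma expansionB n x y : expansion n (x - y) = expansion n x - expansion n y.
Proof.
by rewrite /expansion -sumrB; apply: eq_bigr => i _; rewrite ipBl scalerBl.
Qed.

Lemma expansion_span x : linear_span phi x ->
  exists N, forall n, (N <= n)%N -> expansion n x = x.
Proof.
case=> N [a ->]; exists N => n Nn.
(* The coefficients are extended by zero beyond [N]. *)
pose b j := if insub j is Some i then a i else 0.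
have bE : \sum_(i < N) a i *: phi i = \sum_(i < N) b i *: phi i.
  by apply: eq_bigr => i _; rewrite /b valK.
rewrite bE /expansion.
under eq_bigr do rewrite coef_sum.
rewrite (big_ord_widen n (fun i => b i *: phi i) Nn) [RHS]big_mkcond /=.
by apply: eq_bigr => i _; case: ifP => // _; rewrite scale0r.
Qed.

Lemma sum_normc_homo a :
  {homo (fun n => \sum_(i < n) normc (a i) ^+ 2) : p n / (p <= n)%N >-> p <= n}.
Proof.
move=> p n pn; rewrite (big_ord_widen n (fun i => normc (a i) ^+ 2) pn) big_mkcond.
by apply: ler_sum => i _; case: ifP => // _; exact: sqr_ge0.
Qed.

Let C := Num.sqrt (M / m).

Let C_ge0 : 0 <= C. Proof. exact: sqrtr_ge0. Qed.

Let C_sqr : C ^+ 2 = M / m.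
Proof. by rewrite sqr_sqrtr // divr_ge0 // ltW. Qed.

(** The upper frame bound handles the first [n] coefficients; their square sum only grows when
    enough terms are added to reproduce [x], and there the lower frame bound gives back
    [rnorm x]. *)
Lemma expansion_le_span n x : linear_span phi x ->
  rnorm (expansion n x) <= C * rnorm x.
Proof.
move=> /expansion_span[N HN].
rewrite -(@ler_pXn2r _ 2) ?nnegrE ?mulr_ge0 ?rnorm_ge0 //.
rewrite exprMn C_sqr; have [_ h1] := frame n (fun i => ip x (phis i)).
apply: (le_trans h1); rewrite -mulrA ler_pM2l // mulrC ler_pdivlMr // mulrC.
have [h2 _] := frame (maxn n N) (fun i => ip x (phis i)).
rewrite -[\sum_(i < maxn n N) _ *: _]/(expansion _ _) HN ?leq_maxr // in h2.
apply: le_trans h2; rewrite ler_pM2l //.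
by apply: (@sum_normc_homo (fun i => ip x (phis i))); exact: leq_maxl.
Qed.

(** A crude bound depending on [n]; it only gives the continuity that carries the uniform bound [C]
    from the dense span to all of [X]. *)
Lemma expansion_bounded n :
  exists2 c, 0 <= c & forall x, rnorm (expansion n x) <= c * rnorm x.
Proof.
exists (\sum_(i < n) rnorm (phis i) * rnorm (phi i)).
  by apply: sumr_ge0 => i _; rewrite mulr_ge0 ?rnorm_ge0.
move=> x; rewrite (le_trans (rnorm_sum _ _ _)) // mulr_suml ler_sum // => i _.
rewrite rnormZ mulrAC ler_wpM2r ?rnorm_ge0 // mulrC.
exact: cauchy_schwarz.
Qed.

Lemma expansion_le n x : rnorm (expansion n x) <= C * rnorm x.
Proof.
have [c c0 Hc] := expansion_bounded n.
apply/ler_addgt0Pr => e e0.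
have C1 : 0 < C + c + 1 by rewrite ltr_wpDl // addr_ge0.
have [y sy xy] := dense_rnorm x phi_dense (divr_gt0 e0 C1).
have h1 := expansion_le_span n sy.
have h2 := Hc (x - y).
have h3 : rnorm y <= rnorm x + rnorm (x - y).
  by rewrite rnorm_distC -[in leLHS](subrKC x y) rnormD.
have h4 : rnorm (expansion n x) <= rnorm (expansion n (x - y)) + rnorm (expansion n y).
  by rewrite expansionB -[in leLHS](subrK (expansion n y) (expansion n x)) rnormD.
have h5 : C * rnorm y <= C * (rnorm x + rnorm (x - y)) by rewrite ler_wpM2l.
have h6 : (C + c + 1) * rnorm (x - y) < e by rewrite mulrC -ltr_pdivlMr.
have := rnorm_ge0 (x - y); nra.
Qed.

(** Density argument: expansions are eventually exact on the span and bounded by [C] uniformly in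
    [n]. *)
Lemma expansion_cvg x e : 0 < e ->
  exists N, forall n, (N <= n)%N -> rnorm (expansion n x - x) < e.
Proof.
move=> e0; have C1 : 0 < C + 1 by rewrite ltr_wpDl.
have [y sy xy] := dense_rnorm x phi_dense (divr_gt0 e0 C1).
have [N HN] := expansion_span sy; exists N => n /HN yE.
have -> : expansion n x - x = expansion n (x - y) + (y - x).
  by rewrite expansionB yE addrA subrK.
rewrite (le_lt_trans (rnormD _ _)) // (rnorm_distC y).
have := expansion_le n (x - y).
have : (C + 1) * rnorm (x - y) < e by rewrite mulrC -ltr_pdivlMr.
lra.
Qed.

(** The lower frame bound is applied to [expansion n x], whose norm is at most [C * rnorm x] with
    C^2 = M / m. *)
Lemma riesz_bessel n x :
  \sum_(i < n) normc (ip x (phis i)) ^+ 2 <= M / m ^+ 2 * rnorm x ^+ 2.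
Proof.
have [h _] := frame n (fun i => ip x (phis i)).
rewrite -(ler_pM2l m_gt0) (le_trans h) //.
have -> : m * (M / m ^+ 2 * rnorm x ^+ 2) = (C * rnorm x) ^+ 2.
  by rewrite exprMn C_sqr; field; rewrite gt_eqF.
by rewrite ler_pXn2r ?nnegrE ?mulr_ge0 ?rnorm_ge0 //; exact: expansion_le.
Qed.

Lemma riesz_upper x B :
  (forall n, \sum_(i < n) normc (ip x (phis i)) ^+ 2 <= B) ->
  rnorm x ^+ 2 <= M * B.
Proof.
move=> HB; have B0 : 0 <= B by have := HB 0%N; rewrite big_ord0.
have MB0 : 0 <= M * B by rewrite mulr_ge0 // ltW.
suff : rnorm x <= Num.sqrt (M * B).
  by rewrite -(@ler_pXn2r _ 2) ?nnegrE ?rnorm_ge0 ?sqrtr_ge0 // sqr_sqrtr.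
apply/ler_addgt0Pr => e e0; have [N /(_ N (leqnn _)) HN] := expansion_cvg x e0.
have h : rnorm (expansion N x) <= Num.sqrt (M * B).
  rewrite -(@ler_pXn2r _ 2) ?nnegrE ?rnorm_ge0 ?sqrtr_ge0 // sqr_sqrtr //.
  have [_ h1] := frame N (fun i => ip x (phis i)).
  by rewrite (le_trans h1) // ler_pM2l.
rewrite -[x in leLHS](subKr (expansion N x)) (le_trans (rnormD _ _)) // lerD //.
by rewrite rnormN ltW.
Qed.

(** Case B = 0 of [riesz_upper] for the difference. Vector identities can therefore be checked
    coordinate by coordinate. *)
Lemma coef_ext x y : (forall j, ip x (phis j) = ip y (phis j)) -> x = y.
Proof.
move=> H; apply/eqP; rewrite -subr_eq0 -rnorm_eq0 -sqrf_eq0 eq_le sqr_ge0 andbT.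
rewrite -(mulr0 M); apply: riesz_upper => n.
by rewrite big1 // => i _; rewrite ipBl H subrr normc0 expr0n.
Qed.

(** Riesz-Fischer: the upper frame bound makes the partial sums Cauchy, and completeness supplies
    the vector. *)
Lemma coef_synthesis a B :
  (forall n, \sum_(i < n) normc (a i) ^+ 2 <= B) ->
  exists x, forall j, ip x (phis j) = a j.
Proof.
move=> HB; pose s n := \sum_(i < n) a i *: phi i.
pose S n := \sum_(i < n) normc (a i) ^+ 2.
have sdiff p n : (p <= n)%N -> rnorm (s n - s p) ^+ 2 <= M * (S n - S p).
  move=> pn; pose b i := if (i < p)%N then 0 else a i.
  have -> : s n - s p = \sum_(i < n) b i *: phi i.
    rewrite /s (big_ord_widen n (fun i => a i *: phi i) pn).
    rewrite [X in _ - X]big_mkcond -sumrB; apply: eq_bigr => i _.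
    by rewrite /b; case: ifP; rewrite ?subrr ?scale0r ?subr0.
  have -> : S n - S p = \sum_(i < n) normc (b i) ^+ 2.
    rewrite /S (big_ord_widen n (fun i => normc (a i) ^+ 2) pn).
    rewrite [X in _ - X]big_mkcond -sumrB; apply: eq_bigr => i _.
    by rewrite /b; case: ifP; rewrite ?subrr ?normc0 ?expr0n ?subr0.
  by case: (frame n b).
have [e e0|x Hx] := @rnorm_complete _ _ s.
  have e1 : 0 < (e / 2) ^+ 2 / M by rewrite divr_gt0 // exprn_gt0 // divr_gt0.
  have [N HN] := nondecreasing_bounded_tail (@sum_normc_homo a) HB e1.
  have sN n : (N <= n)%N -> rnorm (s n - s N) < e / 2.
    move=> Nn; rewrite -(@ltr_pXn2r _ 2) ?nnegrE ?rnorm_ge0 // ?divr_ge0 ?ltW //.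
    rewrite (le_lt_trans (sdiff _ _ Nn)) // mulrC -ltr_pdivlMr //; exact: HN.
  exists N => p n /sN hp /sN hn.
  rewrite -[s p - s n](subrKA (s N)) (le_lt_trans (rnormD _ _)) //.
  by rewrite [e]splitr ltrD // rnorm_distC.
exists x => j; apply/eqP; rewrite -subr_eq0 -normc_eq0 eq_le normc_ge0 andbT.
apply/ler_addgt0Pr => e e0; rewrite add0r.
have p0 : 0 < rnorm (phis j) + 1 by rewrite ltr_wpDl ?rnorm_ge0.
have [N HN] := Hx _ (divr_gt0 e0 p0).
(* At least [j.+1] terms are taken, so that the partial sum already has [j]-th coefficient [a j]. *)
have /HN h : (N <= maxn N j.+1)%N by rewrite leq_maxl.
have -> : a j = ip (s (maxn N j.+1)) (phis j).
  by rewrite coef_sum leq_max ltnSn orbT.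
rewrite -ipBl (le_trans (cauchy_schwarz ip_norm _ _)) // rnorm_distC.
rewrite ltr_pdivlMr // in h; have := rnorm_ge0 (s (maxn N j.+1) - x); nra.
Qed.

(** Diagonal operators with bounded symbol: the image comes from [coef_synthesis], linearity from
    uniqueness of coefficients. The reduced resolvents are of this kind. *)
Lemma riesz_multiplier mu c : (forall j, normc (mu j) <= c) ->
  exists S : {linear X -> X},
    (forall x j, ip (S x) (phis j) = mu j * ip x (phis j)) /\
    (forall x, rnorm (S x) <= c * (M / m) * rnorm x).
Proof.
move=> Hmu; have c0 : 0 <= c := le_trans (normc_ge0 _) (Hmu 0%N).
have sumle x n : \sum_(i < n) normc (mu i * ip x (phis i)) ^+ 2 <=
    c ^+ 2 * (M / m ^+ 2 * rnorm x ^+ 2).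
  apply: (@le_trans _ _ (c ^+ 2 * \sum_(i < n) normc (ip x (phis i)) ^+ 2)).
    rewrite mulr_sumr ler_sum // => i _; rewrite normcM exprMn.
    by rewrite ler_wpM2r ?sqr_ge0 // ler_pXn2r ?nnegrE ?normc_ge0.
  by rewrite ler_wpM2l ?sqr_ge0 // riesz_bessel.
have ex x : exists y, forall j, ip y (phis j) = mu j * ip x (phis j).
  exact: (coef_synthesis (sumle x)).
have [f Hf] := choice ex.
have flin : linear f.
  move=> b x y; apply: coef_ext => j.
  by rewrite Hf !ipDl !ipZl !Hf mulrDr mulrCA.
pose F : {linear X -> X} := HB.pack f (GRing.isLinear.Build _ _ _ _ f flin).
exists F; split=> [x j|x]; first exact: Hf.
rewrite -(@ler_pXn2r _ 2) ?nnegrE ?mulr_ge0 ?rnorm_ge0 ?invr_ge0 ?(ltW m_gt0) ?(ltW M_gt0) //.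
have -> : (c * (M / m) * rnorm x) ^+ 2 = M * (c ^+ 2 * (M / m ^+ 2 * rnorm x ^+ 2)).
  by field; rewrite gt_eqF.
apply: riesz_upper => n; rewrite (le_trans _ (sumle x n)) // ler_sum // => i _.
by rewrite Hf.
Qed.

Lemma riesz_basis_bound i : rnorm (phi i) ^+ 2 <= M.
Proof.
rewrite -[M]mulr1; apply: riesz_upper => n.
case: (ltnP i n) => hi.
  rewrite (bigD1 (Ordinal hi)) //= biorth eqxx normc1 expr1n big1 ?addr0 // => j ij.
  rewrite biorth; suff /negbTE -> : i != j by rewrite normc0 expr0n.
  by apply: contra ij => /eqP ij; apply/eqP/val_inj.
rewrite big1 ?ler01 // => j _.
by rewrite biorth gtn_eqF ?normc0 ?expr0n //; exact: leq_trans hi.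
Qed.

Lemma riesz_basis_lower i : m <= rnorm (phi i) ^+ 2.
Proof.
have [] := frame i.+1 (fun j => (j == i)%:R).
rewrite !big_ord_recr /= eqxx scale1r normc1 expr1n !big1 => [|j _|j _].
- by rewrite !add0r mulr1.
- by rewrite (ltn_eqF (ltn_ord j)) scale0r.
- by rewrite (ltn_eqF (ltn_ord j)) normc0 expr0n.
Qed.

End RieszBasis.


(** * Diagonalization of the boundary control system *)

Section LinearOn.
Variables (R : realType) (X Y : lmodType R[i]).
Variables (D : set X) (f : X -> Y).
Hypothesis f_lin : linear_on D f.

Lemma linear_on0 : f 0 = 0.
Proof.
have [D0 /(_ (-1) _ _ D0 D0)[_]] := f_lin.
by rewrite scaler0 addr0 scaleN1r addNr.
Qed.

Lemma linear_onZ a x : D x -> D (a *: x) /\ f (a *: x) = a *: f x.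
Proof.
move=> Dx; have [D0 /(_ a _ _ Dx D0)] := f_lin.
by rewrite linear_on0 !addr0.
Qed.

Lemma linear_onD x y : D x -> D y -> D (x + y) /\ f (x + y) = f x + f y.
Proof. by move=> Dx Dy; have [_ /(_ 1 _ _ Dx Dy)] := f_lin; rewrite !scale1r. Qed.

Lemma linear_onB x y : D x -> D y -> D (x - y) /\ f (x - y) = f x - f y.
Proof.
move=> Dx Dy; have [_ /(_ (-1) _ _ Dy Dx)] := f_lin.
by rewrite !scaleN1r ![- _ + _]addrC.
Qed.

Lemma linear_on_sum n (a : nat -> R[i]) (x : nat -> X) : (forall i, D (x i)) ->
  D (\sum_(i < n) a i *: x i) /\
  f (\sum_(i < n) a i *: x i) = \sum_(i < n) a i *: f (x i).
Proof.
move=> Dx; elim: n => [|n [ih1 ih2]].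
  by rewrite !big_ord0 linear_on0; case: f_lin.
rewrite !big_ord_recr /=; have [h1 h2] := linear_onZ (a n) (Dx n).
by have [h3 ->] := linear_onD ih1 h1; rewrite h2 ih2.
Qed.

End LinearOn.

(** * Closed operators, spectra and the boundary functional *)

Lemma closed_operator_limit (R : realType) (X : normedModType R[i])
    (A : unbounded_operator X X) (u : nat -> X) x y :
  closed_operator A -> (forall n, dom A (u n)) ->
  u n @[n --> \oo] --> x -> A (u n) @[n --> \oo] --> y -> dom A x /\ A x = y.
Proof.
move=> Acl Du ux Auy.
suff : [set p : X * X | dom A p.1 /\ A p.1 = p.2] (x, y) by [].
apply: (@closed_cvg _ _ \oo _ (fun n => (u n, A (u n)) : X * X)) => //.
  by exists 0%N => // n _; split => /=; first exact: Du.
exact: cvg_pair.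
Qed.

Lemma eigenvalue_spectrum (R : realType) (X : normedModType R[i])
    (A : unbounded_operator X X) l : Defs.eigenvalue A l -> spectrum A l.
Proof.
move=> [x [Dx x0 Ax]] [S [_ [_ /(_ x Dx)]]].
by rewrite Ax subrr linear0 => x0'; rewrite -x0' eqxx in x0.
Qed.

(** On an eigenvector for [z] the resolvent at [l] acts as 1 / (l - z), so one bound of the
    resolvent keeps [l] away from all eigenvalues at once. *)
Lemma resolvent_point_gap (R : realType) (X : normedModType R[i])
    (A : unbounded_operator X X) l : resolvent_set A l ->
  exists2 c, 0 < c & forall z, Defs.eigenvalue A z -> c <= normc (l - z).
Proof.
move=> [S [/linear_continuous_rnorm[c c0 Hc] [_ HS]]].
exists c^-1; first by rewrite invr_gt0.
move=> z [x [Dx x0 Ax]]; have /(congr1 (@rnorm R X)) := HS x Dx.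
rewrite Ax -scalerBl => E; have := Hc ((l - z) *: x).
rewrite E rnormZ mulrA -[leLHS]mul1r ler_pM2r ?rnorm_gt0 //.
by rewrite mulrC -ler_pdivrMr // mul1r.
Qed.

(** Density of [dom (Sigma A F)] puts some (h, F h) within distance 1 of (0, 1), which excludes F h
    = 0; it remains to rescale. *)
Lemma boundary_functional_onto (R : realType) (X : normedModType R[i])
    (A : unbounded_operator X X) (F : X -> R[i]) :
  boundary_control_system A F -> exists2 h, dom A h & F h = 1.
Proof.
move=> [Alin Flin dS].
have [||[h c] []] := dS (ball ((0, 1) : X * R[i]^o) 1).
- by exists (0, 1); exact: ballxx.
- exact: ball_open.
case=> _ /= hc [/= Dh Fh].
have Fh0 : F h != 0.
  apply/eqP => F0; move: hc; rewrite -Fh F0 -ball_normE /= subr0.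
  by rewrite normr1 ltxx.
have [h1 h2] := linear_onZ Flin (F h)^-1 Dh.
by exists ((F h)^-1 *: h) => //; rewrite h2 /GRing.scale /= mulVf.
Qed.

Section DiagonalSystem.
Variables (R : realType) (X : completeNormedModType R[i]).
Variable ip : {dot X for conjc}.
Hypothesis ip_norm : forall x : X, `|x| ^+ 2 = ip x x.
Variables phi phis : nat -> X.
Hypothesis biorth : forall i j, ip (phi i) (phis j) = (i == j)%:R.
Hypothesis phi_dense : dense (linear_span phi).
Variables m M : R.
Hypotheses (m_gt0 : 0 < m) (M_gt0 : 0 < M).
Hypothesis frame : forall n (a : nat -> R[i]),
  m * \sum_(i < n) normc (a i) ^+ 2 <= rnorm (\sum_(i < n) a i *: phi i) ^+ 2 /\
  rnorm (\sum_(i < n) a i *: phi i) ^+ 2 <= M * \sum_(i < n) normc (a i) ^+ 2.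
Variables (A : unbounded_operator X X) (F : X -> R[i]) (lam : nat -> R[i]).
Hypothesis bcs : boundary_control_system A F.
Hypothesis A0_closed : closed_operator (system_operator A F).
Hypothesis phi_eigen : forall i, eigenvector (system_operator A F) (lam i) (phi i).
Hypothesis phis_eigen : forall i,
  eigenvector (adjoint ip ip (system_operator A F)) (lam i)^* (phis i).

Let b j := input_operator ip A F (phis j).

Lemma system_operator_coef h j : dom A h -> F h = 0 ->
  ip (A h) (phis j) = lam j * ip h (phis j).
Proof.
move=> Dh Fh; have [[z Hz] _ /= E] := phis_eigen j.
have := @xgetPex _ 0 [set z | adjoint_pair ip ip (system_operator A F) (phis j) z].
rewrite E => /(_ (ex_intro _ z Hz)) /(_ h (conj Dh Fh)) /= ->.
by rewrite (ipZr ip) conjcK.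
Qed.

(** As [b j] is defined through the adjoint of [Sigma A F], [phis j] must be shown to lie in the
    domain of that adjoint, and the first component of the adjoint value must be identified as
    [conjc (lam j) *: phis j]. *)
Lemma boundary_coef h j : dom A h ->
  ip (A h) (phis j) = lam j * ip h (phis j) + F h * b j.
Proof.
have [Alin Flin _] := bcs; have [h0 Dh0 Fh0] := boundary_functional_onto bcs.
pose P := [set z | adjoint_pair (ip_prod ip) ip (Sigma A F) (phis j) z].
(* Subtracting [F x *: h0] from [x] lands in the kernel of [F], where [system_operator_coef]
   applies; the correction gives the second component of the witness. *)
have exP : exists z, P z.
  exists (conjc (lam j) *: phis j,
          conjc (ip (A h0) (phis j) - lam j * ip h0 (phis j) : R[i])) => -[x c] /= [Dx <-].
  have [D1 A1] := linear_onZ Alin (F x) Dh0.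
  have [_ F1] := linear_onZ Flin (F x) Dh0.
  have [D2 A2] := linear_onB Alin Dx D1.
  have [_ F2] := linear_onB Flin Dx D1.
  have F3 : F (x - F x *: h0) = 0.
    by rewrite F2 F1 Fh0 /GRing.scale /= mulr1 subrr.
  have := system_operator_coef j D2 F3.
  rewrite A2 A1 !ipBl !ipZl ip_prodE /= (ipZr ip) !conjcK => /eqP.
  rewrite subr_eq => /eqP ->; ring.
have := @xgetPex _ 0 P exP; rewrite -/(op (adjoint (ip_prod ip) ip (Sigma A F)) (phis j)).
rewrite /P /=.
set zw := xget 0 _ => /= Hzw Dh.
have bE : b j = conjc zw.2.
  rewrite /b /input_operator ip_prodE /= -/zw.
  by rewrite (ip0l ip) add0r mul1r.
have zwE x : dom A x -> ip (A x) (phis j) = ip x zw.1 + F x * b j.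
  by move=> Dx; rewrite (Hzw (x, F x)) //= bE.
suff -> : lam j * ip h (phis j) = ip h zw.1 by exact: zwE.
rewrite -[X in X * _]conjcK -(ipZr ip); congr (ip h _).
apply/eqP; rewrite eq_sym -subr_eq0; apply/eqP.
(* The vector selected by [xget] is not known to be the witness, so first components are compared:
   [w] is orthogonal to every [phi i], whose boundary value is zero, and the [phi i] span a dense
   subspace. *)
set w := zw.1 - _.
have phi_w i : ip (phi i) w = 0.
  have [[Di Fi] _ /= Ai] := phi_eigen i.
  have := zwE _ Di; rewrite system_operator_coef // Fi mul0r addr0 => E.
  by rewrite /w ipBr (ipZr ip) -E conjcK subrr.
apply: rnorm_small_eq0 => e e0.
have [N /(_ N (leqnn _)) HN] := expansion_cvg ip_norm biorth phi_dense m_gt0 M_gt0 frame w e0.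
have nE : rnorm w ^+ 2 = normc (ip (w - expansion ip phi phis N w) w).
  rewrite ipBl [X in _ - X]ip_suml big1 => [|i _].
    by rewrite subr0 ip_rnorm // normc_real ger0_norm ?sqr_ge0.
  by rewrite ipZl phi_w mulr0.
have := cauchy_schwarz ip_norm (w - expansion ip phi phis N w) w.
rewrite -nE (rnorm_distC w (expansion _ _ _ _ _)) expr2.
have [->|w0] := eqVneq w 0; first by rewrite rnorm0 => _; exact: ltW.
by rewrite ler_pM2r ?rnorm_gt0 // => /le_trans; apply; exact: ltW.
Qed.

(** Finite expansions of [h] lie in the domain and are mapped to the expansions of [z]; closedness
    passes to the limit. *)
Lemma system_operator_diagonal h z :
  (forall j, ip z (phis j) = lam j * ip h (phis j)) ->
  [/\ dom A h, F h = 0 & A h = z].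
Proof.
move=> H; have [Alin Flin _] := bcs.
have Dphi i : dom A (phi i) by case: (phi_eigen i) => -[].
suff [[Dh Fh] Ah] : dom (system_operator A F) h /\ system_operator A F h = z by [].
apply: (@closed_operator_limit _ _ _ (fun n => expansion ip phi phis n h)) => //.
- move=> n; have [h1 _] := linear_on_sum Alin n (fun i => ip h (phis i)) Dphi.
  split=> //; have [_ ->] := linear_on_sum Flin n (fun i => ip h (phis i)) Dphi.
  rewrite big1 // => i _; have [[_ ->] _ _] := phi_eigen i.
  by rewrite scaler0.
- by apply/cvg_rnormP => e e0; apply: (expansion_cvg ip_norm biorth phi_dense m_gt0 M_gt0 frame).
- apply/cvg_rnormP => e e0.
  have [N HN] := expansion_cvg ip_norm biorth phi_dense m_gt0 M_gt0 frame z e0.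
  exists N => n /HN; congr (rnorm (_ - _) < _).
  have [_ /= ->] := linear_on_sum Alin n (fun i => ip h (phis i)) Dphi.
  apply: eq_bigr => i _; have [_ _ /= ->] := phi_eigen i.
  by rewrite H scalerA mulrC.
Qed.

(** Subtracting [c *: h0] reduces the converse to zero boundary value. Domain, boundary value and
    image under [A] are thus encoded in one family of scalar equations. *)
Lemma boundary_graph h z c :
  [/\ dom A h, F h = c & A h = z] <->
  (forall j, ip z (phis j) = lam j * ip h (phis j) + c * b j).
Proof.
split=> [[Dh <- <-] j|H]; first exact: boundary_coef.
have [Alin Flin _] := bcs; have [h0 Dh0 Fh0] := boundary_functional_onto bcs.
have [D1 A1] := linear_onZ Alin c Dh0.
have [_ F1] := linear_onZ Flin c Dh0.
have [|D2 F2 A2] := @system_operator_diagonal (h - c *: h0) (z - A (c *: h0)).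
  move=> j; rewrite !ipBl H boundary_coef // F1 Fh0 ipZl /GRing.scale /=; ring.
have [D3 A3] := linear_onD Alin D2 D1.
have [_ F3] := linear_onD Flin D2 D1.
rewrite subrK in D3 A3 F3; split => //.
  by rewrite F3 F2 F1 Fh0 /GRing.scale /= mulr1 add0r.
by rewrite A3 A2 subrK.
Qed.

(** Equal eigenvalues would put [phi i] and [phi j] in the same one-dimensional root space, against
    biorthogonality. *)
Lemma simple_eigenvalues_inj :
  (forall i, simple_eigenvalue (system_operator A F) (lam i)) -> injective lam.
Proof.
move=> simp i j lij; apply/eqP/negPn/negP => ij.
have [_ [e [_ E]]] := simp i.
have ker k : lam k = lam i -> root_space (system_operator A F) (lam i) (phi k).
  move=> lk; exists 1%N; have [Dk _ Ak] := phi_eigen k.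
  by split => //; rewrite /= lk in Ak *; rewrite Ak subrr.
have := ker i erefl; have := ker j (esym lij).
rewrite E => -[a ja] [a' ia].
have := biorth j i; rewrite ja ip_suml big_ord1 ipZl eq_sym (negbTE ij) => /eqP.
have := biorth i i; rewrite {1}ia ip_suml big_ord1 ipZl eqxx => h1.
rewrite mulf_eq0 => /orP[/eqP a0|/eqP e0]; last first.
  by move: h1; rewrite e0 mulr0 => /eqP; rewrite eq_sym oner_eq0.
have := biorth j j; rewrite {1}ja big_ord1 a0 scale0r ip0l eqxx => /eqP.
by rewrite eq_sym oner_eq0.
Qed.

(** If eigenvalues accumulated at [lam i], the compact resolvent would map eigenvectors scaled into
    the unit ball to a sequence bounded away from zero, while its cluster point has all coefficients
    zero. *)
Lemma discrete_isolated : injective lam ->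
  discrete_operator (system_operator A F) ->
  forall i, 0 < dist_to_rest (range lam) (lam i).
Proof.
move=> lam_inj [l0 [S [[_ [_ HS]] Scomp]]] i.
have S_phi j : l0 - lam j != 0 /\ S (phi j) = (l0 - lam j)^-1 *: phi j.
  have [[Dj Fj] j0 /= Aj] := phi_eigen j; have := HS (phi j) (conj Dj Fj).
  rewrite /= Aj -scalerBl linearZ /= => E.
  have n0 : l0 - lam j != 0.
    by apply/eqP => e0; rewrite e0 scale0r in E; rewrite -E eqxx in j0.
  by split => //; rewrite -{2}E scalerA mulVf // scale1r.
rewrite ltNge; apply/negP => dle.
have near_i n : exists j, j != i /\ normc (lam i - lam j) < n.+1%:R^-1.
  set D := [set normc (lam i - w) | w in range lam `\ lam i].
  have hD : has_inf D.
    split; last by exists 0 => _ [w _ <-]; exact: normc_ge0.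
    exists (normc (lam i - lam i.+1)), (lam i.+1) => //; split; first by exists i.+1.
    by move=> /lam_inj/eqP; rewrite eqn_leq ltnn.
  have n0 : 0 < n.+1%:R^-1 :> R by rewrite invr_gt0.
  have [_ [w [[j _ <-] ji] <-] hj] := inf_adherent n0 hD.
  exists j; split; first by apply/eqP => E; apply: ji; rewrite E.
  by rewrite (lt_le_trans hj) // gerDr.
have [js Hjs] := choice near_i.
have sM0 : 0 < Num.sqrt M by rewrite sqrtr_gt0.
pose c := (Num.sqrt M)^-1.
have c0 : 0 < c by rewrite invr_gt0.
pose u n := S (c%:C *: phi (js n)).
have uE n : u n = (c%:C * (l0 - lam (js n))^-1) *: phi (js n).
  by rewrite /u linearZ /= (S_phi _).2 scalerA.
have uin n : (S @` [set x | `|x| <= 1]) (u n).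
  exists (c%:C *: phi (js n)) => //=.
  rewrite rnormE -[1]/(1%:C) lecR rnormZ normc_real gtr0_norm // mulrC.
  rewrite ler_pdivrMr // mul1r -(@ler_pXn2r _ 2) ?nnegrE ?rnorm_ge0 ?sqrtr_ge0 //.
  rewrite sqr_sqrtr ?(ltW M_gt0) //.
  exact: (@riesz_basis_bound _ _ _ ip_norm _ _ biorth phi_dense _ _ m_gt0 M_gt0 frame).
move: Scomp; rewrite /compact_operator precompactE => /(_ (u @ \oo) _)[].
  by exists 0%N => // n _ /=; apply: subset_closure; exact: uin.
move=> q [_ qcl].
have uq e N : 0 < e -> exists2 n, (N <= n)%N & rnorm (q - u n) < e.
  move=> e0; have [||x [/= [n Nn <-] hx]] := qcl (u @` [set n | N <= n]%N) (ball q e%:C).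
  - by exists N => // n /= Nn; exists n.
  - by apply: nbhsx_ballx; rewrite ltcR.
  by exists n => //; move: hx; rewrite -ball_normE /= rnormE ltcR.
have q0 : q = 0.
  apply: (coef_ext ip_norm biorth phi_dense m_gt0 M_gt0 frame) => l.
  rewrite ip0l.
  (* The indices [js n] avoid [i] by construction and eventually avoid any other [l], because
     [lam (js n)] tends to [lam i] and [lam] is injective. *)
  have [N HN] : exists N, forall n, (N <= n)%N -> js n != l.
    have [->|il] := eqVneq l i; first by exists 0%N => n _; case: (Hjs n).
    have d0 : 0 < normc (lam i - lam l).
      by rewrite normc_gt0 subr_eq0 (inj_eq lam_inj) eq_sym.
    exists (Num.bound (normc (lam i - lam l))^-1) => n hn.
    apply/eqP => jl; have [_] := Hjs n; rewrite jl ltNge => /negP; apply.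
    rewrite -[leRHS]invrK lef_pV2 ?posrE ?invr_gt0 //.
    rewrite ltW // (lt_le_trans (archi_boundP _)) ?invr_ge0 ?normc_ge0 //.
    by rewrite ler_nat leqW.
  apply/eqP; rewrite -normc_eq0 eq_le normc_ge0 andbT.
  apply/ler_addgt0Pr => e e0; rewrite add0r.
  have p0 : 0 < rnorm (phis l) + 1 by rewrite ltr_wpDl ?rnorm_ge0.
  have [n /HN nl hn] := uq _ N (divr_gt0 e0 p0).
  have -> : ip q (phis l) = ip (q - u n) (phis l).
    by rewrite ipBl uE ipZl biorth (negbTE nl) mulr0 subr0.
  rewrite (le_trans (cauchy_schwarz ip_norm _ _)) //.
  rewrite ltr_pdivlMr // in hn; have := rnorm_ge0 (q - u n); nra.
have r0 : 0 < normc (l0 - lam i) + 1 by rewrite ltr_wpDl ?normc_ge0.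
have sm0 : 0 < Num.sqrt m by rewrite sqrtr_gt0.
(* The radius is a lower bound of every [rnorm (u n)], since |l0 - lam (js n)| <= |l0 - lam i| + 1;
   the cluster point 0 contradicts it. *)
have [n _] := uq _ 0%N (mulr_gt0 (divr_gt0 c0 r0) sm0).
rewrite q0 sub0r rnormN uE rnormZ normcM normcV normc_real (gtr0_norm c0).
apply/negP; rewrite -leNgt.
have h1 : Num.sqrt m <= rnorm (phi (js n)).
  rewrite -(@ler_pXn2r _ 2) ?nnegrE ?rnorm_ge0 ?sqrtr_ge0 //.
  by rewrite sqr_sqrtr ?(ltW m_gt0) // (riesz_basis_lower frame).
have [d0 _] := S_phi (js n); rewrite -normc_gt0 in d0.
apply: ler_pM; rewrite ?(ltW (divr_gt0 c0 r0)) ?(ltW sm0) //.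
rewrite ler_pM2l // lef_pV2 ?posrE //.
rewrite -[l0 - _](subrKA (lam i)) (le_trans (normcD _ _)) // lerD2l.
have [_ /ltW hj] := Hjs n; apply: (le_trans hj).
by rewrite invf_le1 // ler1n.
Qed.

End DiagonalSystem.


(** * Reduction to one mode *)

(* For l close to lam i only the i-th coordinate of (l - B) h = x may fail to
   be solvable; E and S solve the other coordinates, and eliminating the
   feedback value ip h g leaves a scalar equation with coefficient Delta. *)
Section OneModeReduction.
Variables (R : realType) (X : completeNormedModType R[i]).
Variable ip : {dot X for conjc}.
Hypothesis ip_norm : forall x : X, `|x| ^+ 2 = ip x x.
Variables phi phis : nat -> X.
Hypothesis biorth : forall i j, ip (phi i) (phis j) = (i == j)%:R.
Hypothesis coef_inj : forall x y : X,
  (forall j, ip x (phis j) = ip y (phis j)) -> x = y.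
Variables (lam b : nat -> R[i]) (g : X) (B : unbounded_operator X X).
Hypothesis graph_B : forall h z, dom B h /\ B h = z <->
  (forall j, ip z (phis j) = lam j * ip h (phis j) + ip h g * b j).
Variables (i : nat) (l : R[i]) (E : X) (S : {linear X -> X}) (K : R).
Hypothesis l_neq : forall j, j != i -> l != lam j.
Hypothesis coef_E : forall j,
  ip E (phis j) = if j == i then 0 else b j / (l - lam j).
Hypothesis coef_S : forall x j,
  ip (S x) (phis j) = (if j == i then 0 else (l - lam j)^-1) * ip x (phis j).
Hypothesis S_bound : forall x, rnorm (S x) <= K * rnorm x.

(** What multiplies the feedback value [ip h g] once the solved form of [h] has been paired with
    [g]. *)
Definition feedback_denominator := 1 - ip E g.
Let D := feedback_denominator.
Hypothesis D_neq0 : D != 0.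

(** The Schur complement of the [i]-th mode. *)
Definition characteristic_value := l - lam i - b i * ip (phi i) g / D.
Let Delta := characteristic_value.

(** Every coordinate but the [i]-th can be divided by [l - lam j], which gives the vector formula
    through [S] and [E]; the [i]-th survives as the scalar equation. *)
Lemma mode_equation h x : (dom B h /\ l *: h - B h = x) <->
  (h = ip h (phis i) *: phi i + S x + ip h g *: E /\
   (l - lam i) * ip h (phis i) = ip x (phis i) + ip h g * b i).
Proof.
have -> : (dom B h /\ l *: h - B h = x) <-> (dom B h /\ B h = l *: h - x).
  split=> -[Dh E']; split => //; first by rewrite -E' opprB addrC subrK.
  by rewrite E' opprB addrC subrK.
have lneq j : j != i -> l - lam j != 0 by move=> ji; rewrite subr_eq0 l_neq.
rewrite graph_B; split=> [H|[H1 H2] j].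
  have H' j : (l - lam j) * ip h (phis j) = ip x (phis j) + ip h g * b j.
    have := H j; rewrite ipBl ipZl => /eqP; rewrite subr_eq => /eqP E'.
    by rewrite mulrBl E'; ring.
  split; last exact: H'.
  apply: coef_inj => j; rewrite !ipDl !ipZl biorth coef_S coef_E eq_sym.
  case: eqVneq => [->|ji]; first by rewrite mulr1 mul0r mulr0 !addr0.
  rewrite mulr0 add0r; apply: (mulfI (lneq _ ji)); rewrite H'.
  by field; exact: lneq.
rewrite ipBl ipZl; have [->|ji] := eqVneq j i.
  by have := H2; rewrite mulrBl => /eqP; rewrite subr_eq => /eqP ->; ring.
have hj : ip h (phis j) = (l - lam j)^-1 * ip x (phis j) + ip h g * (b j / (l - lam j)).
  rewrite [in LHS]H1 !ipDl !ipZl biorth coef_S coef_E.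
  by rewrite (negbTE ji) eq_sym (negbTE ji) mulr0 add0r.
by rewrite hj; field; exact: lneq.
Qed.

Lemma feedback_value h x : h = ip h (phis i) *: phi i + S x + ip h g *: E ->
  ip h g * D = ip h (phis i) * ip (phi i) g + ip (S x) g.
Proof.
move=> H; have : ip h g = ip h (phis i) * ip (phi i) g + ip (S x) g + ip h g * ip E g.
  by rewrite {1}H !ipDl !ipZl.
by move=> /eqP; rewrite -subr_eq => /eqP <-; rewrite /D /feedback_denominator; ring.
Qed.

Lemma mode_coefficient h x : dom B h -> l *: h - B h = x ->
  ip h (phis i) * Delta = ip x (phis i) + b i * ip (S x) g / D.
Proof.
move=> Dh hx; have [H1 H2] := (mode_equation h x).1 (conj Dh hx).
have H3 := feedback_value H1.
rewrite /Delta /characteristic_value mulrBr mulrC H2.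
have -> : ip h g = (ip h (phis i) * ip (phi i) g + ip (S x) g) / D.
  by rewrite -H3 mulfK.
by field.
Qed.

Lemma characteristic_resolvent : Delta != 0 -> resolvent_set B l.
Proof.
move=> Delta0.
(* The two scalar equations are solved for the [i]-th coefficient and the feedback value; [ci] and
   [cg] confirm that the candidate [f x] has them. *)
pose al x : R[i] := (ip x (phis i) + b i * ip (S x) g / D) / Delta.
pose t x : R[i] := (al x * ip (phi i) g + ip (S x) g) / D.
pose f x := al x *: phi i + S x + t x *: E.
have allin c x y : al (c *: x + y) = c * al x + al y.
  by rewrite /al linearP !ipDl !ipZl; field; rewrite D_neq0 Delta0.
have tlin c x y : t (c *: x + y) = c * t x + t y.
  by rewrite /t allin linearP !ipDl !ipZl; field.
have flin : linear f.
  move=> c x y; rewrite /f allin tlin linearP !scalerDl !scalerDr !scalerA.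
  by rewrite [LHS](AC (2*2*2) ((1*3*5)*(2*4*6))).
pose T : {linear X -> X} := HB.pack f (GRing.isLinear.Build _ _ _ _ f flin).
have ci x : ip (f x) (phis i) = al x.
  rewrite /f !ipDl !ipZl biorth coef_S coef_E eqxx.
  by rewrite mulr1 mul0r mulr0 !addr0.
have cg x : ip (f x) g = t x.
  have tD : t x * D = al x * ip (phi i) g + ip (S x) g by rewrite divfK.
  rewrite /f !ipDl !ipZl -tD /D /feedback_denominator; ring.
exists T; split.
  pose ca := (rnorm (phis i) + normc (b i / D) * (K * rnorm g)) / normc Delta.
  have al_bd x : normc (al x) <= ca * rnorm x.
    rewrite /al /ca normcM normcV [leRHS]mulrAC ler_wpM2r ?invr_ge0 ?normc_ge0 //.
    rewrite (le_trans (normcD _ _)) // mulrDl lerD //.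
      by rewrite mulrC; exact: cauchy_schwarz.
    rewrite mulrAC normcM -mulrA ler_wpM2l ?normc_ge0 //.
    rewrite (le_trans (cauchy_schwarz ip_norm _ _)) // mulrAC.
    by rewrite ler_wpM2r ?rnorm_ge0.
  pose ct := (ca * normc (ip (phi i) g) + K * rnorm g) / normc D.
  have t_bd x : normc (t x) <= ct * rnorm x.
    rewrite /t /ct normcM normcV [leRHS]mulrAC ler_wpM2r ?invr_ge0 ?normc_ge0 //.
    rewrite (le_trans (normcD _ _)) // mulrDl lerD //.
      by rewrite normcM mulrAC ler_wpM2r ?normc_ge0 ?al_bd.
    rewrite (le_trans (cauchy_schwarz ip_norm _ _)) // mulrAC.
    by rewrite ler_wpM2r ?rnorm_ge0.
  apply: (@linear_rnorm_continuous _ _ T (ca * rnorm (phi i) + K + ct * rnorm E)).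
  move=> x; rewrite (le_trans (rnormD _ _)) // mulrDl lerD //.
    rewrite (le_trans (rnormD _ _)) // mulrDl lerD //.
    by rewrite rnormZ mulrAC ler_wpM2r ?rnorm_ge0 ?al_bd.
  by rewrite rnormZ mulrAC ler_wpM2r ?rnorm_ge0 ?t_bd.
split=> [x|h Dh].
  apply/mode_equation; rewrite ci cg; split => //.
  have -> : l - lam i = Delta + b i * ip (phi i) g / D by rewrite subrK.
  by rewrite /t /al; field; rewrite D_neq0 Delta0.
have [H1 _] := (mode_equation h _).1 (conj Dh erefl).
have H2 := mode_coefficient Dh erefl.
rewrite [RHS]H1; set x := l *: h - B h in H1 H2 *.
have alE : al x = ip h (phis i) by rewrite /al -H2 mulfK.
by rewrite /= /f /t alE -(feedback_value H1) mulfK.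
Qed.

(** Candidate eigenvector with [i]-th coefficient 1; the factor before [E] is its feedback value. *)
Definition mode_vector := phi i + (ip (phi i) g / D) *: E.

Let S_phi : S (phi i) = 0.
Proof.
apply: coef_inj => j; rewrite coef_S biorth ip0l.
by case: (eqVneq j i); rewrite ?mul0r ?mulr0.
Qed.

Let coef_mode_vector : ip mode_vector (phis i) = 1.
Proof. by rewrite ipDl ipZl biorth coef_E eqxx mulr0 addr0. Qed.

Lemma characteristic_eigenvector : Delta = 0 -> eigenvector B l mode_vector.
Proof.
move=> Delta0.
have cg : ip mode_vector g = ip (phi i) g / D.
  have EgE : ip E g = 1 - D by rewrite /D /feedback_denominator subKr.
  by rewrite ipDl ipZl EgE; field.
have [|Dv Bv] := (mode_equation mode_vector 0).2.
- rewrite coef_mode_vector cg scale1r linear0 addr0; split => //.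
  rewrite ip0l add0r mulr1; apply/eqP; rewrite -subr_eq0 -Delta0.
  by rewrite /Delta /characteristic_value; apply/eqP; ring.
split => //; last by apply/esym/eqP; rewrite -subr_eq0; apply/eqP.
apply/eqP => v0; have := coef_mode_vector; rewrite v0 ip0l => /eqP.
by rewrite eq_sym oner_eq0.
Qed.

(** If (l - B) h = c v with v the eigenvector, [mode_coefficient] gives c (1 + b_i <phi_i, g> <S E,
    g> / D^2) = 0. The size condition keeps this factor, the derivative of the characteristic value
    in [l], away from zero, which rules out Jordan chains. *)
Lemma characteristic_simple : Delta = 0 ->
  normc (b i * ip (phi i) g) * normc (ip (S E) g) < normc D ^+ 2 ->
  simple_eigenvalue B l.
Proof.
move=> Delta0 small; have ev := characteristic_eigenvector Delta0.
have D0 : 0 < normc D by rewrite normc_gt0.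
split; first by exists mode_vector.
have range c h : dom B h -> l *: h - B h = c *: mode_vector ->
    c = 0 /\ h = ip h (phis i) *: mode_vector.
  move=> Dh Bh; have := mode_coefficient Dh Bh.
  rewrite Delta0 mulr0 ipZl coef_mode_vector mulr1 linearZ /=.
  rewrite /mode_vector linearD linearZ /= S_phi add0r !ipZl => E0.
  have c0 : c = 0.
    apply/eqP/negPn/negP => cn0.
    have : b i * ip (phi i) g * ip (S E) g = - D ^+ 2.
      apply: (mulfI cn0); apply/eqP; rewrite -subr_eq0; apply/eqP.
      rewrite -(mulr0 (D ^+ 2)) E0; field; exact: D_neq0.
    move=> /(congr1 (@normc R)); rewrite normcN (normcM (_ * _)) expr2 (normcM D) => E1.
    by move: small; rewrite E1 expr2 ltxx.
  split => //; move: Bh; rewrite c0 scale0r => Bh.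
  have [H1 _] := (mode_equation h 0).1 (conj Dh Bh).
  have := feedback_value H1; rewrite linear0 ip0l addr0 => H2.
  rewrite linear0 addr0 in H1.
  rewrite [LHS]H1 /mode_vector scalerDr scalerA; congr (_ + _ *: _).
  by rewrite mulrA -H2 mulfK.
exists (fun _ => mode_vector); split.
  move=> a; rewrite big_ord1 => /eqP; rewrite scaler_eq0.
  have [_ /negbTE -> _] := ev.
  by rewrite orbF => /eqP a0 j; rewrite ord1.
apply/seteqP; split=> h /=.
  move=> [p]; suff : in_ker_pow B l p h -> exists c, h = c *: mode_vector.
    by move=> H /H[c ->]; exists (fun=> c); rewrite big_ord1.
  (* By induction [B h - l *: h] is a multiple of [mode_vector]; [range] then makes [h] one as
     well. *)
  elim: p h => [h /= ->|p ih h /= [Dh /ih[c hc]]]; first by exists 0; rewrite scale0r.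
  have [_ hE] : - c = 0 /\ h = ip h (phis i) *: mode_vector.
    by apply: range; rewrite // scaleNr -hc opprB.
  by exists (ip h (phis i)).
move=> [a ->]; rewrite big_ord1; exists 1%N; have [Dv _ Bv] := ev.
have [Dav Bav] : dom B (a ord0 *: mode_vector) /\
    B (a ord0 *: mode_vector) = a ord0 *: (l *: mode_vector).
  apply/graph_B => j; have /graph_B := conj Dv Bv.
  by move=> /(_ j); rewrite !ipZl => ->; ring.
split => //=.
by rewrite Bav scalerA mulrC -scalerA subrr.
Qed.

End OneModeReduction.


(** * Uniform estimates and localization of the spectrum *)

Section SpectrumPerturbation.
Variables (R : realType) (X : completeNormedModType R[i]).
Variable ip : {dot X for conjc}.
Hypothesis ip_norm : forall x : X, `|x| ^+ 2 = ip x x.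
Variables phi phis : nat -> X.
Hypothesis biorth : forall i j, ip (phi i) (phis j) = (i == j)%:R.
Hypothesis phi_dense : dense (linear_span phi).
Variables m M : R.
Hypotheses (m_gt0 : 0 < m) (M_gt0 : 0 < M).
Hypothesis frame : forall n (a : nat -> R[i]),
  m * \sum_(i < n) normc (a i) ^+ 2 <= rnorm (\sum_(i < n) a i *: phi i) ^+ 2 /\
  rnorm (\sum_(i < n) a i *: phi i) ^+ 2 <= M * \sum_(i < n) normc (a i) ^+ 2.
Variables (lam b : nat -> R[i]) (g : X) (B : unbounded_operator X X).
Hypothesis graph_B : forall h z, dom B h /\ B h = z <->
  (forall j, ip z (phis j) = lam j * ip h (phis j) + ip h g * b j).
Variables (d : nat -> R) (W : R).
Hypothesis d_gt0 : forall i, 0 < d i.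
Hypothesis d_le : forall i j, j != i -> d i <= normc (lam i - lam j).
Hypothesis W_ge0 : 0 <= W.
Hypothesis sum_bound : forall l, (forall i, d i / 3 <= normc (l - lam i)) ->
  forall n, \sum_(j < n) normc (b j / (l - lam j)) ^+ 2 <= W.

Let coef_inj := coef_ext ip_norm biorth phi_dense m_gt0 M_gt0 frame.

Let s := Num.sqrt W.
Let p := Num.sqrt M.
Let K := M / m.
Let G := rnorm g.

(** The norm of [g] weighted by the input bound [s] and the basis bound [p]; smallness conditions
    are stated in terms of it, uniformly in the mode. *)
Definition perturbation_size := s * p * G.
Let Q := perturbation_size.

Let s_ge0 : 0 <= s. Proof. exact: sqrtr_ge0. Qed.
Let p_ge0 : 0 <= p. Proof. exact: sqrtr_ge0. Qed.
Let G_ge0 : 0 <= G. Proof. exact: rnorm_ge0. Qed.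
Let K_ge0 : 0 <= K. Proof. by rewrite divr_ge0 // ltW. Qed.
Let Q_ge0 : 0 <= Q. Proof. by rewrite !mulr_ge0. Qed.

Lemma term_bound l j : (forall i, d i / 3 <= normc (l - lam i)) ->
  normc (b j / (l - lam j)) <= s.
Proof.
move=> /sum_bound/(_ j.+1); rewrite big_ord_recr /= => H.
rewrite -(@ler_pXn2r _ 2) ?nnegrE ?normc_ge0 // sqr_sqrtr //.
by apply: le_trans H; rewrite lerDr sumr_ge0 // => i _; exact: sqr_ge0.
Qed.

Lemma coef_b_bound l j : (forall i, d i / 3 <= normc (l - lam i)) ->
  normc (b j) <= s * normc (l - lam j).
Proof.
move=> H; have := term_bound j H; rewrite normcM normcV ler_pdivrMr //.
by rewrite (lt_le_trans _ (H j)) // divr_gt0.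
Qed.

Lemma phi_g_bound i : normc (ip (phi i) g) <= p * G.
Proof.
rewrite (le_trans (cauchy_schwarz ip_norm _ _)) // ler_wpM2r //.
rewrite -(@ler_pXn2r _ 2) ?nnegrE ?rnorm_ge0 // sqr_sqrtr ?(ltW M_gt0) //.
exact: (@riesz_basis_bound _ _ _ ip_norm _ _ biorth phi_dense _ _ m_gt0 M_gt0 frame).
Qed.

(** The factor [c] is the loss when the summability bound is used at a point other than [l]: 1
    outside the disks, 2 inside one. *)
Lemma reduced_input i l c : 0 <= c ->
  (forall n, \sum_(j < n) normc (if (j : nat) == i then 0 else b j / (l - lam j)) ^+ 2
    <= c ^+ 2 * W) ->
  exists E, [/\ forall j, ip E (phis j) = if j == i then 0 else b j / (l - lam j),
    rnorm E <= c * (s * p) & normc (ip E g) <= c * Q].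
Proof.
move=> c0 H.
have [E HE] := coef_synthesis ip_norm biorth M_gt0 frame
  (a := fun j => if j == i then 0 else b j / (l - lam j)) H.
have Ele : rnorm E <= c * (s * p).
  rewrite -(@ler_pXn2r _ 2) ?nnegrE ?rnorm_ge0 ?mulr_ge0 // !exprMn.
  rewrite !sqr_sqrtr ?(ltW M_gt0) // mulrA mulrC.
  apply: (riesz_upper ip_norm biorth phi_dense m_gt0 M_gt0 frame) => n.
  by under eq_bigr do rewrite HE.
exists E; split => //.
by rewrite (le_trans (cauchy_schwarz ip_norm _ _)) // mulrA ler_wpM2r.
Qed.

Lemma reduced_resolvent i l c : 0 < c ->
  (forall j, j != i -> c <= normc (l - lam j)) ->
  exists S : {linear X -> X},
    (forall x j, ip (S x) (phis j) =
      (if j == i then 0 else (l - lam j)^-1) * ip x (phis j)) /\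
    (forall x, rnorm (S x) <= c^-1 * K * rnorm x).
Proof.
move=> c0 H; apply: (riesz_multiplier ip_norm biorth phi_dense m_gt0 M_gt0 frame).
move=> j; case: eqVneq => [_|/H h]; first by rewrite normc0 invr_ge0 ltW.
by rewrite normcV lef_pV2 // posrE (lt_le_trans c0).
Qed.

Lemma denominator_bound (E : X) : normc (ip E g) <= 2^-1 ->
  2^-1 <= normc (feedback_denominator ip g E).
Proof.
move=> h; have := normcD (feedback_denominator ip g E) (ip E g).
rewrite subrK normc1; lra.
Qed.

(** Mode 0 is an arbitrary choice. A zero characteristic value would force |D| <= Q <= 1/4, against
    |D| >= 1/2. The gap [c] makes [S] bounded even if the [d i] are not bounded below. *)
Lemma exterior_resolvent l c : Q <= 4^-1 ->
  (forall i, d i / 3 <= normc (l - lam i)) ->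
  0 < c -> (forall j, c <= normc (l - lam j)) -> resolvent_set B l.
Proof.
move=> Q4 lout c0 Hc.
have [||E [cE _ Eg]] := @reduced_input 0 l 1; first exact: ler01.
  move=> n; rewrite expr1n mul1r (le_trans _ (sum_bound lout n)) //.
  apply: ler_sum => j _; case: ifP => // _.
  by rewrite normc0 expr0n sqr_ge0.
have [|S [cS Sb]] := @reduced_resolvent 0 l c c0; first by move=> j _.
have Eg2 : normc (ip E g) <= 2^-1 by move: Eg; rewrite mul1r; lra.
have Db := denominator_bound Eg2.
set D := feedback_denominator ip g E in Db.
have D0 : 0 < normc D by apply: lt_le_trans Db.
apply: (characteristic_resolvent ip_norm biorth coef_inj graph_B _ cE cS Sb).
- by move=> j _; rewrite -subr_eq0 -normc_gt0 (lt_le_trans c0).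
- by rewrite -normc_gt0.
have l0 : 0 < normc (l - lam 0) by apply: lt_le_trans (Hc 0%N).
rewrite /characteristic_value subr_eq0; apply/eqP => /(congr1 (@normc R)).
rewrite -/D normcM normcV normcM => /eqP; rewrite -(inj_eq (mulIf (lt0r_neq0 D0))).
rewrite divfK ?lt0r_neq0 // => /eqP E1.
have h1 := coef_b_bound 0 lout; have h2 := phi_g_bound 0.
have h3 : normc (b 0) * normc (ip (phi 0) g) <= normc (l - lam 0) * Q.
  apply: (@le_trans _ _ (s * normc (l - lam 0) * (p * G))).
    by rewrite ler_pM ?normc_ge0.
  by rewrite le_eqVlt /Q /perturbation_size; apply/orP; left; apply/eqP; ring.
rewrite -E1 ler_pM2l // in h3; lra.
Qed.

(** * The spectrum inside one disk *)

Section Disk.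
Variable i : nat.
Hypothesis KQ : 8 * K * Q ^+ 2 <= 1.

Let in_disk l := normc (l - lam i) <= d i / 3.

(** Moving by d_i / 3 loses at most a third of |lam_i - lam_j| >= d_i. *)
Lemma far_from_rest l j : in_disk l -> j != i ->
  2 / 3 * normc (lam i - lam j) <= normc (l - lam j).
Proof.
move=> ld /d_le ji; have := normcD (lam i - l) (l - lam j).
by rewrite subrKA (normc_distC _ l); move: ld; rewrite /in_disk; lra.
Qed.

(** A point on the boundary of the [i]-th disk; it lies outside all open disks, so the summability
    bound holds there. *)
Let z0 := lam i + (d i / 3)%:C.

Let z0_disk : normc (z0 - lam i) = d i / 3.
Proof. by rewrite addrC addKr normc_real ger0_norm // ltW // divr_gt0. Qed.

Lemma reference_point_exterior j : d j / 3 <= normc (z0 - lam j).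
Proof.
have [->|ji] := eqVneq j i; first by rewrite z0_disk.
have := @far_from_rest z0 j _ ji; rewrite /in_disk z0_disk => /(_ (lexx _)).
have := @d_le j i; rewrite eq_sym => /(_ ji); rewrite normc_distC.
have := normc_ge0 (lam i - lam j); lra.
Qed.

(** The [i]-th term of the sum at [z0], whose distance to [lam i] is exactly d_i / 3. *)
Lemma disk_b_bound : normc (b i) <= s * (d i / 3).
Proof. by rewrite -z0_disk; apply: coef_b_bound; exact: reference_point_exterior. Qed.

Lemma disk_b_g_bound : normc (b i * ip (phi i) g) <= Q * (d i / 3).
Proof.
rewrite normcM.
apply: (@le_trans _ _ (s * (d i / 3) * (p * G))).
  by rewrite ler_pM ?normc_ge0 ?phi_g_bound ?disk_b_bound.
by rewrite le_eqVlt /Q /perturbation_size; apply/orP; left; apply/eqP; ring.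
Qed.

(** Inside the disk |z0 - lam_j| <= (4/3) |lam_i - lam_j| <= 2 |l - lam_j|, so each term is at most
    twice the one at [z0]. *)
Lemma disk_reduced_input l : in_disk l ->
  exists E, [/\ forall j, ip E (phis j) = if j == i then 0 else b j / (l - lam j),
    rnorm E <= 2 * (s * p) & normc (ip E g) <= 2 * Q].
Proof.
move=> ld; apply: reduced_input => [//|n].
apply: (@le_trans _ _ (2 ^+ 2 * \sum_(j < n) normc (b j / (z0 - lam j)) ^+ 2)).
  rewrite mulr_sumr; apply: ler_sum => j _; rewrite -exprMn.
  rewrite ler_pXn2r ?nnegrE ?mulr_ge0 ?normc_ge0 //.
  case: eqVneq => [_|ji]; first by rewrite normc0 mulr_ge0 ?normc_ge0.
  rewrite !normcM !normcV mulrCA ler_wpM2l ?normc_ge0 //.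
  have h1 := far_from_rest ld ji; have h2 := d_le ji; have h3 := d_gt0 i.
  have h4 : normc (z0 - lam j) <= d i / 3 + normc (lam i - lam j).
    by rewrite -z0_disk -[z0 - lam j](subrKA (lam i)) normcD.
  have h5 : 0 < normc (z0 - lam j).
    by rewrite (lt_le_trans _ (reference_point_exterior j)) // divr_gt0.
  rewrite -[2]invrK -invfM lef_pV2 ?posrE; [lra | lra | by rewrite mulr_gt0].
rewrite ler_pM2l //; apply: sum_bound; exact: reference_point_exterior.
Qed.

Lemma disk_reduced_resolvent l : in_disk l ->
  exists S : {linear X -> X},
    (forall x j, ip (S x) (phis j) =
      (if j == i then 0 else (l - lam j)^-1) * ip x (phis j)) /\
    (forall x, rnorm (S x) <= (2 / 3 * d i)^-1 * K * rnorm x).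
Proof.
move=> ld; apply: reduced_resolvent; first by rewrite mulr_gt0.
move=> j ji; apply: le_trans (far_from_rest ld ji).
by rewrite ler_pM2l // d_le.
Qed.

(** The eigenvalue is a fixed point found in the disk of radius eps d_i / 6; the contraction
    estimate on the whole disk of radius d_i / 3 excludes other spectral points there. *)
Lemma disk_spectrum eps : 0 < eps -> eps < 1 -> Q <= eps / 4 ->
  exists z, [/\ normc (z - lam i) <= eps * d i / 6, simple_eigenvalue B z &
    forall l, in_disk l -> spectrum B l -> l = z].
Proof.
move=> e0 e1 Qe; have di := d_gt0 i.
(* [E] is needed as a function of [l]; outside the disk it gets the default 0. *)
have exE l : exists E, in_disk l ->
    [/\ forall j, ip E (phis j) = if j == i then 0 else b j / (l - lam j),
    rnorm E <= 2 * (s * p) & normc (ip E g) <= 2 * Q].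
  case: (pselect (in_disk l)) => [/disk_reduced_input[E HE]|ld]; first by exists E.
  by exists 0 => /ld.
have [E HE] := choice exE.
pose D l := feedback_denominator ip g (E l).
have Db l : in_disk l -> 2^-1 <= normc (D l).
  by case/HE => _ _ h; apply: denominator_bound; lra.
have D0 l : in_disk l -> D l != 0.
  by move=> ld; rewrite -normc_gt0 (lt_le_trans _ (Db l ld)).
have SE l w (S : {linear X -> X}) : in_disk l -> in_disk w ->
    (forall x, rnorm (S x) <= (2 / 3 * d i)^-1 * K * rnorm x) ->
    normc (ip (S (E w)) g) <= 3 * K * Q / d i.
  move=> ld /HE[_ Ew _] Sb.
  rewrite (le_trans (cauchy_schwarz ip_norm _ _)) //.
  apply: (@le_trans _ _ ((2 / 3 * d i)^-1 * K * (2 * (s * p)) * G)).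
    rewrite ler_wpM2r // (le_trans (Sb _)) // ler_wpM2l //.
    by rewrite mulr_ge0 // invr_ge0 mulr_ge0 // ltW.
  rewrite le_eqVlt /Q /perturbation_size; apply/orP; left; apply/eqP; field.
  by rewrite gt_eqF.
(* A point of the disk is fixed by [T] exactly when its characteristic value vanishes. *)
pose T l := lam i + b i * ip (phi i) g / D l.
have Tr l : in_disk l -> normc (T l - lam i) <= eps * d i / 6.
  move=> ld; rewrite addrC addKr normcM normcV ler_pdivrMr ?normc_gt0 ?D0 //.
  rewrite (le_trans disk_b_g_bound) //.
  have h1 := Db l ld; have h2 : Q * (d i / 3) <= eps / 4 * (d i / 3).
    by rewrite ler_wpM2r // divr_ge0 // ltW.
  have h3 : eps * d i / 6 * 2^-1 <= eps * d i / 6 * normc (D l).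
    by rewrite ler_wpM2l // divr_ge0 // mulr_ge0 // ltW.
  have := mulr_gt0 e0 di; lra.
have Tc z w : in_disk z -> in_disk w -> normc (T z - T w) <= 2^-1 * normc (z - w).
  move=> zd wd; have [S [cS Sb]] := disk_reduced_resolvent zd.
  have [cEz _ _] := HE z zd; have [cEw _ _] := HE w wd.
  (* A resolvent identity: in each coordinate a difference of reciprocals factors, which yields the
     Lipschitz factor [z - w]. *)
  have Ezw : E z - E w = (w - z) *: S (E w).
    apply: coef_inj => j; rewrite ipBl ipZl cS cEz cEw.
    case: eqVneq => [_|ji]; first by rewrite !mul0r mulr0 subr0.
    have n0 l : in_disk l -> l - lam j != 0.
      move=> ld; rewrite -normc_gt0 (lt_le_trans _ (far_from_rest ld ji)) //.
      by rewrite mulr_gt0 // (lt_le_trans di) // d_le.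
    by field; rewrite !n0.
  have -> : T z - T w = b i * ip (phi i) g * ((w - z) * ip (S (E w)) g) / (D z * D w).
    have <- : ip (E z) g - ip (E w) g = (w - z) * ip (S (E w)) g.
      by rewrite -ipBl Ezw ipZl.
    have -> : ip (E z) g - ip (E w) g = D w - D z.
      by rewrite /D /feedback_denominator; ring.
    by rewrite /T; field; rewrite !D0.
  have Dzw : 4^-1 <= normc (D z * D w).
    have -> : 4^-1 = 2^-1 * 2^-1 :> R by field.
    by rewrite normcM ler_pM ?Db.
  have Dzw0 : 0 < normc (D z * D w) by apply: lt_le_trans Dzw.
  rewrite [leLHS]normcM normcV ler_pdivrMr // normcM (normcM (w - z)) (normc_distC w).
  apply: (@le_trans _ _ (Q * (d i / 3) * (normc (z - w) * (3 * K * Q / d i)))).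
    rewrite ler_pM ?normc_ge0 ?mulr_ge0 ?normc_ge0 ?disk_b_g_bound //.
    by rewrite ler_wpM2l ?normc_ge0 // (SE z).
  (* The powers of d_i cancel, so the estimate is uniform in [i]; with |D z| |D w| >= 1/4 the
     constant is 4 K Q^2 <= 1/2 by [KQ]. *)
  have -> : Q * (d i / 3) * (normc (z - w) * (3 * K * Q / d i)) = K * Q ^+ 2 * normc (z - w).
    by field; rewrite gt_eqF.
  rewrite [leRHS]mulrAC ler_wpM2r ?normc_ge0 //.
  by move: KQ Dzw; rewrite -(mulrA 8); lra.
have r_le : eps * d i / 6 <= d i / 3 by nra.
have [|||z [zr Tz]] := @disk_fixed_point _ T (lam i) (eps * d i / 6).
- by rewrite divr_ge0 // mulr_ge0 // ltW.
- by move=> z zr; apply: Tr; exact: le_trans r_le.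
- by move=> z w zr wr; apply: Tc; exact: le_trans r_le.
have zd : in_disk z by exact: le_trans r_le.
have lneq l : in_disk l -> forall j, j != i -> l != lam j.
  move=> ld j ji; rewrite -subr_eq0 -normc_gt0 (lt_le_trans _ (far_from_rest ld ji)) //.
  by rewrite mulr_gt0 // (lt_le_trans di) // d_le.
exists z; split => //.
  have [S [cS Sb]] := disk_reduced_resolvent zd; have [cE _ _] := HE z zd.
  apply: (characteristic_simple biorth coef_inj graph_B (lneq z zd) cE cS (D0 z zd)).
    by rewrite /characteristic_value -/(D z) -[in X in X - _]Tz /T; ring.
  apply: (@le_lt_trans _ _ (Q * (d i / 3) * (3 * K * Q / d i))).
    by rewrite ler_pM ?normc_ge0 ?disk_b_g_bound // (SE z).
  have -> : Q * (d i / 3) * (3 * K * Q / d i) = K * Q ^+ 2.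
    by field; rewrite gt_eqF.
  apply: (@lt_le_trans _ _ (2^-1 ^+ 2)); first by move: KQ; rewrite -(mulrA 8); lra.
  by rewrite ler_pXn2r ?nnegrE ?normc_ge0 // Db.
move=> l ld lspec.
have [S [cS Sb]] := disk_reduced_resolvent ld; have [cE _ _] := HE l ld.
have Tl : T l = l.
  apply: contrapT => /eqP Tl; apply: lspec.
  apply: (characteristic_resolvent ip_norm biorth coef_inj graph_B (lneq l ld) cE cS Sb (D0 l ld)).
  rewrite /characteristic_value -/(D l) -addrA -opprD subr_eq0 eq_sym.
  exact: Tl.
have := Tc _ _ ld zd; rewrite Tl Tz => h.
apply/eqP; rewrite -subr_eq0 -normc_eq0 eq_le normc_ge0 andbT; lra.
Qed.

End Disk.

End SpectrumPerturbation.


(** * The closed loop as a perturbation of the desired system *)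

Lemma dist_to_rest_le (R : realType) (S : set R[i]) (z w : R[i]) :
  S w -> w != z -> dist_to_rest S z <= normc (z - w).
Proof.
move=> Sw wz; apply: ge_inf.
  by exists 0 => _ [v _ <-]; exact: normc_ge0.
by exists w => //; split => //; exact/eqP.
Qed.

(** On [dom A] the gain decomposition reads Rb - Kring = kappa Rdc + <., k>, so the closed-loop
    condition becomes a small feedback on [Rdc]; [kappa] is real and passes through the
    conjugate-linear slot unchanged. *)
Lemma closed_loop_graph (R : realType) (X : completeNormedModType R[i])
    (ip : {dot X for conjc}) (A : unbounded_operator X X)
    (Rb Rdc Kring : X -> R[i]) (kappa : R) (k k' : X) h :
  kappa != 0 ->
  (forall h, dom A h -> Rb h - kappa%:C * Rdc h = Kring h + ip h k) ->
  dom (closed_loop ip A (fun h => Rb h - Kring h) k') h <->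
  dom A h /\ Rdc h = ip h ((kappa^-1)%:C *: (k' - k)).
Proof.
move=> kappa0 gain.
have kappaC : kappa%:C != 0 :> R[i] by rewrite -normc_gt0 normc_real normr_gt0.
have ipg : ip h ((kappa^-1)%:C *: (k' - k)) = (kappa%:C)^-1 * (ip h k' - ip h k).
  by rewrite (ipZr ip) conjc_real fmorphV ipBr.
rewrite ipg; split=> /= -[Dh E]; split=> //; have := gain h Dh.
  move=> /eqP; rewrite subr_eq => /eqP RbE.
  by rewrite -E RbE; field.
move=> /eqP; rewrite subr_eq => /eqP RbE.
by rewrite RbE E; field.
Qed.

Theorem mainTheorem1
  (R : realType) (X : completeNormedModType R[i]) (ip : {dot X for conjc})
  (ip_norm : forall x : X, `|x| ^+ 2 = ip x x)
  (X_separable : separable X)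
  (* the plant *)
  (A : unbounded_operator X X) (Rb : X -> R[i])
  (bcs : boundary_control_system A Rb)
  (A_gen : generates_C0_semigroup (system_operator A Rb))
  (* the desired system *)
  (Rdc : X -> R[i])
  (Rdc_bounded : bounded_functional A Rdc)
  (bcs_dc : boundary_control_system A Rdc)
  (* the feedback gain and its decomposition *)
  (kappa : R) (kappa_neq0 : kappa != 0)
  (gain_bounded : bounded_functional A (fun h => Rb h - kappa%:C * Rdc h))
  (Kring : X -> R[i]) (Kring_bounded : bounded_functional A Kring) (k : X)
  (gain_decomp : forall h, dom A h ->
     Rb h - kappa%:C * Rdc h = Kring h + ip h k)
  (* the approximation of the bounded part *)
  (Xn : nat -> set X)
  (Xn_dim : forall n, has_dimension n (Xn n))
  (Xn_approx : forall x : X, exists xn : nat -> X,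
     (forall n, Xn n (xn n)) /\ xn n @[n --> \oo] --> x)
  (kn : nat -> X)
  (kn_in : forall n, Xn n (kn n))
  (kn_cvg : kn n @[n --> \oo] --> k)
  (* the spectral data of the desired system operator *)
  (lam : nat -> R[i]) (phi phis : nat -> X)
  (dc_spectrum : spectrum (system_operator A Rdc) = range lam)
  (dc_discrete : discrete_operator (system_operator A Rdc))
  (dc_riesz : riesz_spectral (system_operator A Rdc) lam phi)
  (dc_simple : forall i, simple_eigenvalue (system_operator A Rdc) (lam i))
  (phis_eigen : forall i,
     eigenvector (adjoint ip ip (system_operator A Rdc)) (lam i)^* (phis i))
  (biorth : forall i j, ip (phi i) (phis j) = (i == j)%:R)
  (M : R) (M_ge0 : 0 <= M)
  (sum_bound : forall l : R[i],
     ~ (\bigcup_i isolating_disk (range lam) 1 (lam i)) l ->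
     (\sum_(0 <= i <oo)
        (normc (input_operator ip A Rdc (phis i) / (l - lam i)) ^+ 2)%:E
      <= M%:E)%E) :
  forall eps : R, 0 < eps -> eps < 1 ->
  exists n0 : nat, forall n : nat, (n0 <= n)%N ->
    let Acl := closed_loop ip A (fun h => Rb h - Kring h) (kn n) in
    exists lamcl : nat -> R[i],
      spectrum Acl = range lamcl /\
      spectrum Acl `<=` \bigcup_i isolating_disk (range lam) eps (lam i) /\
      (forall i,
         spectrum Acl `&` isolating_disk (range lam) eps (lam i)
           = [set lamcl i] /\
         simple_eigenvalue Acl (lamcl i)).
Proof.
have [A0_closed phi_eigen riesz] := dc_riesz.
have [phi_dense [m [L [m0 L0 frame]]]] := riesz_basis_bounds riesz.
have lam_inj := simple_eigenvalues_inj biorth phi_eigen dc_simple.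
pose d i := dist_to_rest (range lam) (lam i).
have d0 i : 0 < d i.
  exact: (discrete_isolated ip_norm biorth phi_dense m0 L0 frame phi_eigen).
have d_le i j : j != i -> d i <= normc (lam i - lam j).
  by move=> ji; apply: dist_to_rest_le; [exists j | rewrite (inj_eq lam_inj)].
pose b j := input_operator ip A Rdc (phis j).
have exterior l : (forall i, d i / 3 <= normc (l - lam i)) <->
    ~ (\bigcup_i isolating_disk (range lam) 1 (lam i)) l.
  split=> [H [i _]|H i]; first by rewrite /isolating_disk /= mul1r ltNge H.
  rewrite leNgt; apply/negP => li; apply: H; exists i => //.
  by rewrite /isolating_disk /= mul1r.
have sum_b l : (forall i, d i / 3 <= normc (l - lam i)) ->
    forall n, \sum_(j < n) normc (b j / (l - lam j)) ^+ 2 <= M.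
  move=> /exterior/sum_bound H n; rewrite -lee_fin; apply: le_trans H.
  rewrite -sumEFin -(big_mkord xpredT (fun j => (normc (b j / (l - lam j)) ^+ 2)%:E)).
  by apply: nneseries_lim_ge => j _ _; rewrite lee_fin sqr_ge0.
move=> eps e0 e1.
pose K := L / m; pose c := Num.sqrt M * Num.sqrt L.
have K0 : 0 <= K by rewrite divr_ge0 // ltW.
have c0 : 0 <= c by rewrite mulr_ge0 ?sqrtr_ge0.
(* Chosen so that Q <= q gives both Q <= eps / 4 and 8 K Q^2 <= 1. *)
pose q := eps / 4 / (8 * K + 1).
have K1 : 0 < 8 * K + 1 by rewrite ltr_wpDl // mulr_ge0.
have q0 : 0 < q by rewrite !divr_gt0.
(* [c] may vanish, so [c + 1] serves as the divisor. *)
have c1 : 0 < c + 1 by rewrite ltr_wpDl.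
have kap0 : 0 < `|kappa| by rewrite normr_gt0.
have [n0 Hn0] := (cvg_rnormP _ _).1 kn_cvg _ (mulr_gt0 kap0 (divr_gt0 q0 c1)).
exists n0 => n /Hn0 hn Acl.
pose g : X := (kappa^-1)%:C *: (kn n - k).
pose Q := perturbation_size L g M.
have g_ge0 := rnorm_ge0 g.
have Qq : Q <= q.
  have gq : rnorm g <= q / (c + 1).
    by rewrite rnormZ normc_real normfV mulrC ler_pdivrMr // mulrC ltW.
  rewrite ler_pdivlMr // in gq; rewrite /Q /perturbation_size -/c; nra.
have Q0 : 0 <= Q by rewrite !mulr_ge0 ?sqrtr_ge0.
have Q1 : (8 * K + 1) * Q <= eps / 4 by rewrite mulrC -ler_pdivlMr.
have Qe : Q <= eps / 4 by nra.
have Q4 : Q <= 4^-1 by lra.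
have KQ : 8 * K * Q ^+ 2 <= 1 by nra.
have graph_cl h z : dom Acl h /\ Acl h = z <->
    (forall j, ip z (phis j) = lam j * ip h (phis j) + ip h g * b j).
  rewrite -(boundary_graph ip_norm biorth phi_dense m0 L0 frame bcs_dc A0_closed
    phi_eigen phis_eigen).
  rewrite (closed_loop_graph _ _ kappa_neq0 gain_decomp).
  by split=> [[[]]|[]].
have ex i := disk_spectrum ip_norm biorth phi_dense m0 L0 frame graph_cl d0 d_le
  M_ge0 sum_b i KQ e0 e1 Qe.
have [lamcl Hcl] := choice ex.
have disk i w : isolating_disk (range lam) eps (lam i) w -> normc (w - lam i) <= d i / 3.
  rewrite /isolating_disk /= -/(d i) => /ltW h; apply: (le_trans h).
  by rewrite ler_pM2r // ger_pMl // ltW.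
have lamcl_disk i : isolating_disk (range lam) eps (lam i) (lamcl i).
  have [h _ _] := Hcl i; rewrite /isolating_disk /= -/(d i) (le_lt_trans h) //.
  by have := mulr_gt0 e0 (d0 i); lra.
have lamcl_spec i : spectrum Acl (lamcl i).
  by have [_ [ev _] _] := Hcl i; exact: eigenvalue_spectrum.
have spec l : spectrum Acl l -> exists i, l = lamcl i.
  (* Either [l] lies outside every open disk of radius d_i / 3, hence off [range lam], and the gap
     of the desired resolvent feeds [exterior_resolvent]; or it lies in one such disk and equals its
     [lamcl i]. *)
  move=> ls; have [lext|] := pselect (forall i, d i / 3 <= normc (l - lam i)).
    exfalso; apply: ls.
    have : resolvent_set (system_operator A Rdc) l.
      apply: contrapT; change (~ spectrum (system_operator A Rdc) l); rewrite dc_spectrum.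
      move=> [j _ lj]; have := lext j; rewrite -lj subrr normc0 leNgt.
      by rewrite divr_gt0.
    move=> /resolvent_point_gap[gap gap0 Hgap].
    apply: (exterior_resolvent ip_norm biorth phi_dense m0 L0 frame graph_cl d0
      M_ge0 sum_b Q4 lext gap0).
    by move=> j; apply: Hgap; exists (phi j).
  move=> /existsNP[i /negP]; rewrite -ltNge => /ltW li.
  by exists i; have [_ _] := Hcl i; apply.
exists lamcl; split.
  by apply/seteqP; split=> [l /spec[i ->]|_ [i _ <-]] //; exists i.
split; first by move=> l /spec[i ->]; exists i.
move=> i; split; last by case: (Hcl i).
apply/seteqP; split=> [l [ls /disk ld]|_ ->]; last by split.
by have [_ _] := Hcl i; apply.
Qed.
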